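(* Let $\mu>0$, let $\nu,a:\mathbb{R}\to\mathbb{R}$ be measurable with $\frac1\mu\le\nu(x)\le\mu$ and $\frac1\mu\le a(x)\le\mu$ for a.e. $x\in\mathbb{R}$, and let $W\in\mathbb{R}$ be a constant. There exists a unique solution $T$ of $$-\big(a(x)\nu(x)T'\big)'+WT'=W\nu(x)\ \text{ in }\mathbb{R},\qquad T(0)=0,$$ such that $T(x)/|x|$ is bounded over $\mathbb{R}$. Moreover, one has $m\le T'(x)\le M$ for all $x\in\mathbb{R}$, for $m=1/\mu^5$ and $M=\mu^5$.
   Context: The functions $\nu$ and $a$ are the coefficients, and $W$ the constant drift, of the canonical parabolic equation $\nu(x)\partial_t p-\partial_x\big(\nu(x)a(x)\partial_x p\big)+W\partial_x p=0$ on $(0,\infty)\times\mathbb{R}$. A prime denotes differentiation in $x$.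
   Formalization: Uniqueness is claimed only for W ≠ 0 (for W = 0 every T = c∫1/(aν) is a solution); existence with the bounds is kept for all W. Solutions are weak, and m ≤ T' ≤ M holds for a.e. x and wherever T is differentiable. *)

(* Defs.v *)
From HB Require Import structures.
From mathcomp Require Import all_boot all_order all_algebra.
From mathcomp Require Import all_classical all_reals all_analysis.

Set Implicit Arguments.
Unset Strict Implicit.
Unset Printing Implicit Defensive.

Import Order.TTheory GRing.Theory Num.Theory.
Import numFieldNormedType.Exports.

Local Open Scope classical_set_scope.
Local Open Scope ring_scope.

(* Test functions of class C^1_c. *)
Definition test_function (R : realType) (phi : R -> R) : Prop :=
  [/\ forall x, derivable phi x 1,
      continuous (derive1 phi) &
      compact (closure [set x | phi x != 0])].

Definition weak_derivative (R : realType) (f g : R -> R) : Prop :=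
  [/\ locally_integrable setT f,
      locally_integrable setT g &
      forall phi, test_function phi ->
        \int[lebesgue_measure]_x (f x * derive1 phi x) =
        - \int[lebesgue_measure]_x (g x * phi x)].

(* The coefficients are only measurable, so - (a nu T')' + W T' = W nu is
   understood in the weak (distributional) sense: T is the continuous
   representative of a function of W^{1,1}_loc whose weak derivative T' = g
   satisfies the equation tested against every phi. *)
Definition weak_solution (R : realType) (nu a : R -> R) (W : R) (T : R -> R) :
    Prop :=
  continuous T /\
  exists2 g : R -> R, weak_derivative T g &
    forall phi, test_function phi ->
      \int[lebesgue_measure]_x
        (a x * nu x * g x * derive1 phi x + W * g x * phi x) =
      \int[lebesgue_measure]_x (W * nu x * phi x).

Definition at_most_linear (R : realType) (T : R -> R) : Prop :=
  exists C : R, forall x, x != 0 -> `|T x / `|x| | <= C.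

(* For a continuous T with a locally integrable weak derivative, T' exists as a
   weak derivative (defined up to null sets) and as a classical derivative at
   almost every point, but not everywhere; the bounds are required of both. *)
Definition derivative_between (R : realType) (m M : R) (T : R -> R) : Prop :=
  (forall g, weak_derivative T g ->
    {ae lebesgue_measure, forall x, m <= g x <= M}) /\
  (forall x, derivable T x 1 -> m <= derive1 T x <= M).

(* Main.v *)
Require Import Defs.
From HB Require Import structures.
From mathcomp Require Import all_boot all_order all_algebra.
From mathcomp Require Import all_classical all_reals all_analysis.
From mathcomp Require Import measurable_realfun ring lra.

(* Write b = 1 / (a nu) and h = a nu T', so that the equation reads
   h' = W (b h - nu).  Reflecting x to - x, assume W > 0.  With lam an upper
   bound of b and om = W lam, a bounded solution is a fixed point of
   h |-> A ((nu + (lam - b) h) / lam), where A k averages k against the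
   exponential probability density om exp (- om (y - x)) on [x, +oo[.  This
   map is monotone and preserves the functions with values between the
   constants m and M as soon as m b <= nu <= M b; since nu / b = a nu ^ 2, one
   may take m = 1 / mu ^ 3 and M = mu ^ 3.  The iterates starting from M
   decrease to a solution, and T' = b h gives the bounds mu ^ (-5), mu ^ 5.
   For uniqueness, the difference D of two solutions satisfies
   a nu D' = W D + k almost everywhere for a constant k, so u = W D + k solves
   u' = W b u, and a nonzero solution of this grows faster than linearly in
   one direction. *)

Set Implicit Arguments.
Unset Strict Implicit.
Unset Printing Implicit Defensive.

Import Order.TTheory GRing.Theory Num.Theory.
Import numFieldNormedType.Exports.

Local Open Scope classical_set_scope.
Local Open Scope ring_scope.

(** The coefficients being only measurable, no classical theory of differential equations applies.
    All equations are handled as integral identities for continuous functions; integration by parts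
    and a du Bois-Reymond argument translate them to and from the weak form. This is why the flux
    [h] is the unknown: it is continuous, while [T' = b h] inherits the jumps of [b]. Adding [om h]
    to both sides of the flux equation makes [(lam - b) / lam], the coefficient of [h] in the
    source, nonnegative; this gives the monotonicity. The homogeneous solutions of [v' = om v] are
    multiples of [exp (om x)], unbounded at +oo when [om > 0], so a bounded solution must be
    integrated backwards from +oo. For [W < 0] the roles of the two ends are exchanged, whence the
    reflection. The exponent 5 is 2 + 3: [b] lies between [mu ^ (-2)] and [mu ^ 2], and [h] between
    [mu ^ (-3)] and [mu ^ 3]. For [W = 0] uniqueness is false: every multiple of a primitive of [b]
    that vanishes at 0 solves the problem. Hence the condition [W != 0] on that part alone. *)

(** * Local integrability and functions of compact support *)

Section basics.
Variable R : realType.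
Notation leb := (@lebesgue_measure R).
Implicit Types (f g h phi F : R -> R) (A a b c x y : R).

Lemma locally_integrable_segment f a b :
  locally_integrable setT f -> leb.-integrable `[a, b] (EFin \o f).
Proof.
move=> [mf _ foo]; apply/integrableP; split.
  by apply/measurable_EFinP; exact: measurable_funTS.
exact: foo (subsetT _) (@segment_compact _ a b).
Qed.

Lemma locally_integrableM f h : locally_integrable setT f ->
  measurable_fun setT h ->
  (forall K, compact K -> [bounded h x | x in K]) ->
  locally_integrable setT (fun x => h x * f x).
Proof.
move=> [mf _ foo] mh bh; split; [exact: measurable_funM|exact: openT|].
move=> K _ cK; have mK := compact_measurable cK.
suff /integrableP[] : leb.-integrable K (EFin \o (fun x => h x * f x)) by [].
apply: (@eq_integrable _ _ _ leb _ mK ((EFin \o h) \* (EFin \o f))%E) => //.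
apply: integrableMr => //; [exact: measurable_funTS|exact: bh|].
apply/integrableP; split; last exact: foo.
by apply/measurable_EFinP; exact: measurable_funTS.
Qed.

Lemma continuous_locally_bounded h : continuous h ->
  forall K : set R, compact K -> [bounded h x | x in K].
Proof.
move=> ch K cK.
have /compact_bounded[M [_ mrt]] :=
  continuous_compact (@continuous_subspaceT _ _ K h ch) cK.
by exists M; split; rewrite ?num_real // => ? ? ? ?; exact: mrt.
Qed.

Lemma boundedP h c : (forall x, `|h x| <= c) ->
  forall K : set R, [bounded h x | x in K].
Proof.
move=> hc K; exists c; split; first exact: num_real.
by move=> M cM x _ /=; rewrite (le_trans (hc x))// ltW.
Qed.

Lemma locally_integrable_cst c : locally_integrable setT (cst c : R -> R).
Proof.
split; [exact: measurable_cst|exact: openT|move=> K _ cK].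
rewrite [ltLHS](_ : _ = \int[leb]_(x in K) (cst `|c|%:E) x)%E//.
rewrite integral_cst//=; last exact: compact_measurable.
by rewrite lte_mul_pinfty// ?lee_fin// compact_finite_measure.
Qed.

Lemma continuous_locally_integrable h :
  continuous h -> locally_integrable setT h.
Proof.
move=> ch; have := @locally_integrableM _ h (locally_integrable_cst 1)
  (continuous_measurable_fun ch) (continuous_locally_bounded ch).
by under [X in locally_integrable _ X]eq_fun do rewrite mulr1.
Qed.

Lemma bounded_locally_integrable h c : measurable_fun setT h ->
  (forall x, `|h x| <= c) -> locally_integrable setT h.
Proof.
move=> mh hc; have := @locally_integrableM _ h (locally_integrable_cst 1)
  mh (fun K _ => boundedP hc K).
by under [X in locally_integrable _ X]eq_fun do rewrite mulr1.
Qed.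

(** Compact support with an explicit radius, so that integrals over the line reduce to integrals
    over a segment. *)
Definition vanishes_off (A : R) (f : R -> R) := forall x, A < `|x| -> f x = 0.

Lemma vanishes_off_restrict f A : vanishes_off A f -> f \_ `[- A, A] = f.
Proof.
move=> fA; apply/funext => x; rewrite patchE; case: ifPn => //.
rewrite notin_setE /= in_itv/= => /negP; rewrite -ler_norml -ltNge => /fA.
by move=> ->.
Qed.

Lemma integrable_vanishes_off f A : locally_integrable setT f ->
  vanishes_off A f -> leb.-integrable setT (EFin \o f).
Proof.
move=> lf fA; rewrite -(vanishes_off_restrict fA).
rewrite -restrict_EFin; apply/integrable_restrict => //=; rewrite setTI.
exact: locally_integrable_segment.
Qed.

Lemma Rintegral_vanishes_off f A : vanishes_off A f ->
  \int[leb]_x f x = \int[leb]_(x in `[- A, A]) f x.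
Proof. by move=> fA; rewrite [RHS]Rintegral_mkcond (vanishes_off_restrict fA). Qed.

Lemma test_function_vanishes phi : test_function phi ->
  exists A, [/\ 0 < A, vanishes_off A phi & vanishes_off A (derive1 phi)].
Proof.
move=> [dphi cphi /compact_bounded[M [_ bM]]].
have clM x : closure [set x | phi x != 0] x -> `|x| <= `|M| + 1.
  by apply: (bM (`|M| + 1)); rewrite (le_lt_trans (ler_norm _))// ltrDl.
have nz x : `|M| + 1 < `|x| -> ~ closure [set x | phi x != 0] x.
  by move=> Mx /clM; rewrite leNgt Mx.
exists (`|M| + 1); split => [|x /nz nx|x /nz nx].
- by rewrite ltr_wpDl.
- apply: contrapT => /eqP phix; apply: nx; exact: subset_closure.
(* Outside the closed support [phi] vanishes on a whole neighbourhood, so its derivative vanishes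
   there too and one radius serves both. *)
- have oC : open (~` closure [set x | phi x != 0]).
    exact/closed_openC/closed_closure.
  have : \near x, phi x = 0.
    have : nbhs x (~` closure [set x | phi x != 0]) by exact: open_nbhs_nbhs.
    apply: filterS => y ny; apply: contrapT => /eqP phiy.
    by apply: ny; exact: subset_closure.
  move=> near0; rewrite derive1E (@near_eq_derive _ _ _ phi (cst 0) x 1 near0).
  by rewrite derive_cst.
Qed.

Lemma test_functionP phi A : (forall x, derivable phi x 1) ->
  continuous (derive1 phi) -> vanishes_off A phi -> test_function phi.
Proof.
move=> dphi cphi phiA; split => //.
apply: (@subclosed_compact _ _ `[- A, A]);
  [exact: closed_closure|exact: segment_compact|].
rewrite closureE => x; apply; split; first exact: itv_closed.
move=> y /= phiy; rewrite in_itv/= -ler_norml leNgt; apply/negP => /phiA.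
exact/eqP.
Qed.

Lemma derivable_continuous phi : (forall x, derivable phi x 1) ->
  continuous phi.
Proof. by move=> d x; apply: differentiable_continuous; exact/derivable1_diffP. Qed.

Lemma test_function_continuous phi : test_function phi -> continuous phi.
Proof. by case=> + _ _; exact: derivable_continuous. Qed.

Lemma locally_integrable_continuousM f h : locally_integrable setT f ->
  continuous h -> locally_integrable setT (fun x => f x * h x).
Proof.
move=> lf ch; under [X in locally_integrable _ X]eq_fun do rewrite mulrC.
by apply: locally_integrableM => //;
  [exact: continuous_measurable_fun|exact: continuous_locally_bounded].
Qed.

Lemma integrable_testM f h A : locally_integrable setT f ->
  continuous h -> vanishes_off A h ->
  leb.-integrable setT (EFin \o (fun x => f x * h x)).
Proof.
move=> lf ch hA; apply: (@integrable_vanishes_off _ A).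
  exact: locally_integrable_continuousM.
by move=> x /hA ->; rewrite mulr0.
Qed.

Lemma integrable_test f phi : locally_integrable setT f ->
  test_function phi -> leb.-integrable setT (EFin \o (fun x => f x * phi x)).
Proof.
move=> lf tp; have [A [_ pA _]] := test_function_vanishes tp.
by apply: integrable_testM lf _ pA; exact: test_function_continuous.
Qed.

Lemma integrable_derive_test f phi : locally_integrable setT f ->
  test_function phi ->
  leb.-integrable setT (EFin \o (fun x => f x * derive1 phi x)).
Proof.
move=> lf tp; have [A [_ _ pA]] := test_function_vanishes tp.
by apply: integrable_testM lf _ pA; case: tp.
Qed.

End basics.

(** * Primitives of locally integrable functions *)

Section primitives.
Variable R : realType.
Notation leb := (@lebesgue_measure R).
Implicit Types (f g h phi psi F : R -> R) (A a b c x y z : R).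

Lemma Rintegral_segmentD f x y z : locally_integrable setT f ->
  x <= y -> y <= z ->
  \int[leb]_(t in `[x, z]) f t =
  \int[leb]_(t in `[x, y]) f t + \int[leb]_(t in `[y, z]) f t.
Proof.
move=> lf xy yz; apply/eqP; rewrite addrC -subr_eq; apply/eqP.
rewrite Rintegral_itvB ?bnd_simp//; last exact: locally_integrable_segment.
rewrite Rintegral_itv_obnd_cbnd//.
apply: (@integrableS _ _ _ leb `[y, z]) => //; first exact: subset_itv_oc_cc.
exact: locally_integrable_segment.
Qed.

(** Integral form of [F' = f]: it determines [F] up to a constant and makes sense for [f] merely
    locally integrable. *)
Definition primitive_of F f := forall x y, x <= y ->
  F y - F x = \int[leb]_(t in `[x, y]) f t.

(** The oriented integral from 0 to [x]: for [x != 0] one of the two segments is empty. *)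
Definition primitive0 f x :=
  \int[leb]_(t in `[0, x]) f t - \int[leb]_(t in `[x, 0]) f t.

Lemma Rintegral_segment_gt f x y : y < x -> \int[leb]_(t in `[x, y]) f t = 0.
Proof. by move=> yx; rewrite set_itv_ge ?bnd_simp -?ltNge// Rintegral_set0. Qed.

Lemma primitive0_0 f : primitive0 f 0 = 0.
Proof. by rewrite /primitive0 subrr. Qed.

Lemma primitive0P f : locally_integrable setT f -> primitive_of (primitive0 f) f.
Proof.
move=> lf x y xy; rewrite /primitive0.
have seg0 z : \int[leb]_(t in `[z, z]) f t = 0.
  by rewrite set_itv1 Rintegral_set1.
have [x0|x0] := leP 0 x; have [y0|y0] := leP 0 y.
- rewrite (Rintegral_segmentD lf x0 xy).
  have z0 z : 0 <= z -> \int[leb]_(t in `[z, 0]) f t = 0.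
    rewrite le_eqVlt => /predU1P[<-|]; first exact: seg0.
    exact: Rintegral_segment_gt.
  rewrite !z0//; lra.
- lra.
- rewrite (Rintegral_segment_gt _ x0) (Rintegral_segmentD lf (ltW x0) y0).
  have -> : \int[leb]_(t in `[y, 0]) f t = 0.
    move: y0; rewrite le_eqVlt => /predU1P[<-|]; first exact: seg0.
    exact: Rintegral_segment_gt.
  lra.
- rewrite (Rintegral_segment_gt _ x0) (Rintegral_segment_gt _ y0).
  rewrite (Rintegral_segmentD lf xy (ltW y0)); lra.
Qed.

(** Locally, [F] becomes a constant plus an integral with fixed lower limit, the form to which
    continuity of the integral and the fundamental theorem apply. *)
Lemma primitive_nearE F f x : locally_integrable setT f -> primitive_of F f ->
  \forall y \near x, F y = F (x - 1) + \int[leb]_(t in `[x - 1, y]) f t.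
Proof.
move=> lf Ff; near=> y.
have : x - 1 <= y by apply/ltW; near: y; apply: lt_nbhsr; lra.
by move=> /Ff <-; rewrite addrC subrK.
Unshelve. all: by end_near. Qed.

Lemma primitive_continuous F f : locally_integrable setT f ->
  primitive_of F f -> continuous F.
Proof.
move=> lf Ff x; have x11 : x - 1 <= x + 1 by lra.
have := parameterized_integral_continuous x11
  (@locally_integrable_segment _ _ (x - 1) (x + 1) lf).
rewrite continuous_within_itvP; last by lra.
move=> [+ _ _] => /(_ x); rewrite in_itv/= => /(_ ltac:(lra)) cx.
apply: (@cvg_trans _ ((fun y => F (x - 1) + \int[leb]_(t in `[x - 1, y]) f t)
  @ nbhs x)).
  apply: near_eq_cvg; have := primitive_nearE x lf Ff.
  by apply: filterS => y ->.
rewrite (nbhs_singleton (primitive_nearE x lf Ff)).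
by apply: cvgD => //; exact: cvg_cst.
Qed.

Lemma primitive_derivable F f x : continuous f -> primitive_of F f ->
  derivable F x 1 /\ derive1 F x = f x.
Proof.
move=> cf Ff; have lf := continuous_locally_integrable cf.
have x01 : x - 1 < x by lra.
have x12 : x < x + 1 by lra.
have [dG G'] := continuous_FTC1_closed x12
  (@locally_integrable_segment _ _ (x - 1) (x + 1) lf) x01 (cf x).
have : is_derive x 1 F (f x).
  have dG1 : is_derive x 1 (fun y => \int[leb]_(t in `[x - 1, y]) f t) (f x).
    by apply: DeriveDef => //; rewrite -derive1E.
  apply: (@near_eq_is_derive _ _ _ (cst (F (x - 1)) +
    (fun y => \int[leb]_(t in `[x - 1, y]) f t))).
    have := primitive_nearE x lf Ff.
    by apply: filterS => y ->.
  by rewrite -[f x]add0r; exact: is_deriveD.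
by case=> dF <-; rewrite derive1E.
Qed.

Lemma derive_primitive F f : (forall x, derivable F x 1) ->
  derive1 F = f -> continuous f -> primitive_of F f.
Proof.
move=> dF F'f cf x y; rewrite le_eqVlt => /predU1P[<-|xy].
  by rewrite set_itv1 Rintegral_set1 subrr.
have cF := derivable_continuous dF.
rewrite /Rintegral (continuous_FTC2 xy (F := F)) //.
- exact: continuous_subspaceT.
- split=> [z _||]; first exact: dF.
    by apply: cvg_at_right_filter; exact: cF.
  by apply: cvg_at_left_filter; exact: cF.
- by move=> z _; rewrite F'f.
Qed.

Lemma Rintegral_vanishes_segment f x y :
  (forall t, x <= t <= y -> f t = 0) -> \int[leb]_(t in `[x, y]) f t = 0.
Proof.
move=> f0; rewrite (@eq_Rintegral _ _ _ leb _ (cst 0)) ?Rintegral_cst ?mul0r//.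
by move=> t; rewrite inE /= in_itv/= => /f0.
Qed.

Lemma vanishes_off_le A B f : A <= B -> vanishes_off A f -> vanishes_off B f.
Proof. by move=> AB fA x Bx; apply: fA; exact: le_lt_trans Bx. Qed.

(** The primitive of [psi] that vanishes far to the left also vanishes far to the right, because the
    total integral is zero. *)
Lemma mean_zero_test psi A : continuous psi -> vanishes_off A psi ->
  \int[leb]_x psi x = 0 ->
  exists phi, test_function phi /\ derive1 phi = psi.
Proof.
move=> cpsi psiA i0; have lpsi := continuous_locally_integrable cpsi.
pose P := primitive0 psi; have PP : primitive_of P psi := primitive0P lpsi.
(* [A] may be negative; [B] exceeds both [A] and 0. *)
pose B := `|A| + 1; have AB : A < B by have := ler_norm A; rewrite /B; lra.
have B0 : 0 < B by rewrite /B; have := normr_ge0 A; lra.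
pose phi := P \- cst (P (- B)).
have phiE x : derivable phi x 1 /\ derive1 phi x = psi x.
  apply: primitive_derivable => // y z yz.
  by rewrite -(PP _ _ yz) /phi /=; lra.
exists phi; split; last by apply/funext => x; case: (phiE x).
apply: (@test_functionP _ _ B) => [x|x|x Bx]; first by case: (phiE x).
  rewrite /continuous_at (proj2 (phiE x)).
  suff -> : derive1 phi = psi by exact: cpsi.
  by apply/funext => y; case: (phiE y).
have left y : y < - B -> P y = P (- B).
  move=> yB; apply/eqP; rewrite eq_sym -subr_eq0; apply/eqP.
  rewrite PP; last exact: ltW.
  apply: Rintegral_vanishes_segment => t /andP[_ tB]; apply: psiA.
  by rewrite (lt_le_trans AB)// ler0_norm; lra.
rewrite /phi /=; have [x0|x0] := leP 0 x.
  have xB : B < x by rewrite ger0_norm in Bx.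
  rewrite -(left (- x)) ?ltrN2// PP; last by lra.
  by rewrite -Rintegral_vanishes_off//; apply: vanishes_off_le psiA; lra.
by rewrite left ?subrr// ltrNr; move: Bx; rewrite ltr0_norm.
Qed.

Lemma Rintegral_derive_test phi : test_function phi ->
  \int[leb]_x derive1 phi x = 0.
Proof.
move=> tp; have [A [A0 pA p'A]] := test_function_vanishes tp.
have AA : A <= A + 1 by lra.
rewrite (Rintegral_vanishes_off (vanishes_off_le AA p'A)).
case: tp => dp cp _.
rewrite -(derive_primitive dp) //; last by lra.
by rewrite !pA ?subrr// ?normrN gtr0_norm; lra.
Qed.

End primitives.

(** * Integration by parts and the du Bois-Reymond lemma *)

Section weak.
Variable R : realType.
Notation leb := (@lebesgue_measure R).
Implicit Types (f g h phi psi F : R -> R) (A a b c x y z : R).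

Lemma integrable_boundedM d (T : measurableType d)
    (m : {measure set T -> \bar R}) (D : set T) (u v : T -> R) c :
  measurable D -> measurable_fun D v -> (forall t, `|v t| <= c) ->
  m.-integrable D (EFin \o u) ->
  m.-integrable D (EFin \o (fun t => u t * v t)).
Proof.
move=> mD mv vc iu.
apply: (@eq_integrable _ _ _ m _ mD ((EFin \o u) \* (EFin \o v))%E) => //.
apply: integrableMl => //; exists c; split; first exact: num_real.
by move=> M cM t _ /=; rewrite (le_trans (vc t))// ltW.
Qed.

Lemma integrable_restrict_segment f a b : locally_integrable setT f ->
  leb.-integrable setT (EFin \o (f \_ `[a, b])).
Proof.
move=> lf; rewrite -restrict_EFin; apply/integrable_restrict => //=.
by rewrite setTI; exact: locally_integrable_segment.
Qed.

Lemma integrable_scale d (T : measurableType d)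
    (m : {measure set T -> \bar R}) (D : set T) (u : T -> R) c :
  measurable D -> m.-integrable D (EFin \o u) ->
  m.-integrable D (EFin \o (fun t => c * u t)).
Proof.
move=> mD iu; have := integrableZl mD c iu.
by apply: eq_integrable => // t _ /=.
Qed.

Lemma integrable_scaler d (T : measurableType d)
    (m : {measure set T -> \bar R}) (D : set T) (u : T -> R) c :
  measurable D -> m.-integrable D (EFin \o u) ->
  m.-integrable D (EFin \o (fun t => u t * c)).
Proof.
move=> mD /(integrable_scale c mD).
by apply: eq_integrable => // t _ /=; rewrite mulrC.
Qed.

(** Integrability of every slice, not just of almost every one, makes all inner integrals finite, so
    that [fine] can be moved outside. *)
Lemma Rintegral_Fubini (G : R * R -> R) :
  (leb \x leb)%E.-integrable setT (EFin \o G) ->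
  (forall x, leb.-integrable setT (fun y => (G (x, y))%:E)) ->
  (forall y, leb.-integrable setT (fun x => (G (x, y))%:E)) ->
  \int[leb]_x \int[leb]_y G (x, y) = \int[leb]_y \int[leb]_x G (x, y).
Proof.
move=> iG iGx iGy; rewrite /Rintegral; congr fine.
transitivity (\int[leb]_x \int[leb]_y (G (x, y))%:E)%E.
  by apply: eq_integral => x _; rewrite fineK// integrable_fin_num.
rewrite (Fubini iG); apply: eq_integral => x _.
by rewrite fineK// integrable_fin_num.
Qed.

(** Integration by parts through Fubini: [phi' x * f y] is integrated over the region [y <= x].
    Integrating in [y] first gives [(F x - F (- A)) * phi' x], where the constant drops out since
    [phi'] has integral zero; integrating in [x] first gives [- f y * phi y]. *)
Lemma weak_derivative_primitive F f : locally_integrable setT f ->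
  primitive_of F f -> weak_derivative F f.
Proof.
move=> lf Ff; have cF := primitive_continuous lf Ff.
split=> //; first exact: continuous_locally_integrable.
move=> phi tp; have [A [A0 pA p'A]] := test_function_vanishes tp.
have [dp cp' _] := tp; have cp := derivable_continuous dp.
have lp' := continuous_locally_integrable cp'.
have Pp : primitive_of phi (derive1 phi) by exact: derive_primitive.
have mf : measurable_fun setT f by case: lf.
pose fA := f \_ `[- A, A].
have lfA : leb.-integrable setT (EFin \o fA).
  exact: integrable_restrict_segment.
have mfA : measurable_fun setT fA.
  by case/integrableP: lfA => /measurable_EFinP.
pose le1 x y : R := if y <= x then 1 else 0.
have le1_le x y : `|le1 x y| <= 1.
  by rewrite /le1; case: ifP; rewrite ?normr1 ?normr0.
have mle1 : measurable_fun setT (fun xy : R * R => le1 xy.1 xy.2).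
  apply: measurable_fun_ifT => //.
  by apply: measurable_fun_ler; [exact: measurable_snd|exact: measurable_fst].
pose G (xy : R * R) := derive1 phi xy.1 * fA xy.2 * le1 xy.1 xy.2.
have ip' : leb.-integrable setT (EFin \o derive1 phi).
  exact: integrable_vanishes_off p'A.
have mp' : measurable_fun setT (derive1 phi) by exact: continuous_measurable_fun.
have mH : measurable_fun setT
    (fun xy : R * R => derive1 phi xy.1 * fA xy.2).
  by apply: measurable_funM; apply: measurableT_comp.
have iG : (leb \x leb)%E.-integrable setT (EFin \o G).
  apply: (@integrable_boundedM _ _ _ _ _ _ 1) => //.
  apply/integrable12ltyP; first exact/measurable_EFinP.
  rewrite (_ : (\int[leb]_x _)%E =
      (\int[leb]_x (`|derive1 phi x|%:E * \int[leb]_y `|fA y|%:E))%E).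
    move/integrableP: ip' => [_ ip']; move/integrableP: lfA => [_ ifA].
    rewrite ge0_integralZr//=; last 2 first.
      by apply/measurable_EFinP; exact: measurableT_comp.
      by apply: integral_ge0.
    apply: lte_mul_pinfty => //; first by apply: integral_ge0 => x _; rewrite lee_fin.
    by rewrite ge0_fin_numE//; apply: integral_ge0 => x _; rewrite lee_fin.
  apply: eq_integral => x _; rewrite -ge0_integralZl//=.
    by apply: eq_integral => y _ /=; rewrite normrM EFinM.
  by apply/measurable_EFinP; exact: measurableT_comp.
have ml1 x : measurable_fun setT (le1 x).
  exact: (measurableT_comp mle1 (measurable_pair1 x)).
have ml2 y : measurable_fun setT (le1 ^~ y).
  exact: (measurableT_comp mle1 (measurable_pair2 y)).
have iGx x : leb.-integrable setT (fun y => (G (x, y))%:E).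
  have : leb.-integrable setT
      (EFin \o (fun y => (derive1 phi x * fA y) * le1 x y)).
    apply: (integrable_boundedM (c := 1)) => //; first exact: ml1.
    exact: integrable_scale.
  exact.
have iGy y : leb.-integrable setT (fun x => (G (x, y))%:E).
  have : leb.-integrable setT
      (EFin \o (fun x => (fA y * derive1 phi x) * le1 x y)).
    apply: (integrable_boundedM (c := 1)) => //; first exact: ml2.
    exact: integrable_scale.
  by apply: eq_integrable => // x _; rewrite /G /= [fA y * _]mulrC.
have inner_y x : \int[leb]_y G (x, y) = (F x - F (- A)) * derive1 phi x.
  have [/p'A p'x|] := ltP A `|x|.
    rewrite /G /= p'x mulr0.
    by under eq_Rintegral do rewrite !mul0r; rewrite Rintegral_cst// mul0r.
  rewrite ler_norml => /andP[Ax xA].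
  rewrite (Ff _ _ Ax) mulrC [X in _ * X]Rintegral_mkcond -RintegralZl//; last first.
    exact: integrable_restrict_segment.
  apply: eq_Rintegral => y _; rewrite /G /= -mulrA; congr (_ * _).
  rewrite /fA /le1 !patchE !mem_setE !in_itv/=.
  case: (boolP (y <= x)) => yx; last by rewrite andbF mulr0.
  by rewrite mulr1 (le_trans yx xA).
have inner_x y : \int[leb]_x G (x, y) = - (f y * phi y).
  have [Ay|] := ltP A `|y|.
    rewrite pA// mulr0 oppr0 /G /=.
    have -> : fA y = 0.
      by rewrite /fA patchE mem_setE in_itv/= -ler_norml leNgt Ay.
    by under eq_Rintegral do rewrite mulr0 mul0r; rewrite Rintegral_cst// mul0r.
  move=> yA; have fAy : fA y = f y.
    by rewrite /fA patchE mem_setE in_itv/= -ler_norml yA.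
  (* [vanishes_off] is silent at [A] itself, hence the right end [A + 1], where [phi] is known to be
     0. *)
  have yA1 : y <= A + 1 by move: yA; rewrite ler_norml; lra.
  have := Pp _ _ yA1; rewrite (pA (A + 1)) ?sub0r; last first.
    by rewrite gtr0_norm; lra.
  move=> py; rewrite -mulrN py [X in _ * X]Rintegral_mkcond -RintegralZl//; last first.
    exact: integrable_restrict_segment.
  apply: eq_Rintegral => x _; rewrite /G /= fAy mulrAC mulrC; congr (_ * _).
  rewrite /le1 !patchE !mem_setE !in_itv/=.
  case: (boolP (y <= x)) => yx /=; last by rewrite mulr0.
  rewrite mulr1; case: (leP x (A + 1)) => // Ax.
  by rewrite p'A// gtr0_norm; lra.
have := Rintegral_Fubini iG iGx iGy.
under eq_Rintegral do rewrite inner_y.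
under [X in _ = X -> _]eq_Rintegral do rewrite inner_x.
have iFp := integrable_derive_test (continuous_locally_integrable cF) tp.
have ifp := integrable_test lf tp.
under eq_Rintegral do rewrite mulrBl.
rewrite RintegralB//; last exact: integrable_scale.
rewrite RintegralZl// Rintegral_derive_test// mulr0 subr0 => ->.
under eq_Rintegral do rewrite -mulN1r.
by rewrite RintegralZl// mulN1r.
Qed.

(** An unnormalised approximate identity at [x]. Continuity is enough smoothness, since tents serve
    to build derivatives of test functions. *)
Definition tent x e t : R := Num.max 0 (e - `|t - x|).

Lemma tent_ge0 x e t : 0 <= tent x e t.
Proof. by rewrite /tent le_max lexx. Qed.

Lemma tent_continuous x e : continuous (tent x e).
Proof.
move=> t; have c0 : {for t, continuous (cst 0 : R -> R^o)} by exact: cvg_cst.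
have c1 : {for t, continuous ((fun t => e - `|t - x|) : R -> R^o)}.
  apply: cvgB; first exact: cvg_cst.
  by apply: cvg_norm; apply: cvgB; [exact: cvg_id|exact: cvg_cst].
exact: (continuous_max c0 c1).
Qed.

Lemma tent_out x e t : e <= `|t - x| -> tent x e t = 0.
Proof. by move=> et; rewrite /tent max_l// subr_le0. Qed.

Lemma tent_vanishes x e : vanishes_off (`|x| + e) (tent x e).
Proof.
move=> t xt; apply: tent_out.
have : `|t| <= `|t - x| + `|x| by rewrite -{1}(subrK x t) ler_normD.
lra.
Qed.

Lemma integrable_tent x e : leb.-integrable setT (EFin \o tent x e).
Proof.
apply: integrable_vanishes_off (@tent_vanishes x e).
exact/continuous_locally_integrable/tent_continuous.
Qed.

Lemma Rintegral_tent_gt0 x e : 0 < e -> 0 < \int[leb]_t tent x e t.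
Proof.
(* The tent is at least [e / 2] within distance [e / 2] of its centre. *)
move=> e0; apply: (@lt_le_trans _ _ (e / 2 * (e / 2 + e / 2))); first nra.
have -> : e / 2 * (e / 2 + e / 2) =
   \int[leb]_t (cst (e / 2) \_ `[x - e / 2, x + e / 2]) t.
  rewrite -Rintegral_mkcond Rintegral_cst//; congr (_ * _).
  have mE : lebesgue_measure `[x - e / 2, x + e / 2] = (e / 2 + e / 2)%:E.
    rewrite lebesgue_measure_itv/= lte_fin ifT; last by lra.
    by rewrite -EFinD; congr EFin; lra.
  exact: (congr1 fine (esym mE)).
apply: le_Rintegral => //.
- exact/integrable_restrict_segment/locally_integrable_cst.
- exact: integrable_tent.
- move=> t _; rewrite patchE; case: ifPn => [|_]; last exact: tent_ge0.
  rewrite inE/= in_itv/= => xt.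
  have : `|t - x| <= e / 2 by rewrite ler_norml; lra.
  by rewrite /tent le_max /= => ?; apply/orP; right; lra.
Qed.

(** The difference of two normalised tents has mean zero, hence is the derivative of a test
    function; so the tent averages of [F] around [x] and [y] coincide. As the width shrinks they
    approach [F x] and [F y]. *)
Lemma continuous_weakly_constant F : continuous F ->
  (forall phi, test_function phi -> \int[leb]_x (F x * derive1 phi x) = 0) ->
  forall x y, F x = F y.
Proof.
move=> cF hF x y.
have near_avg z d : 0 < d -> \forall e \near 0^'+,
    `|\int[leb]_t (F t * tent z e t) - F z * \int[leb]_t tent z e t| <=
    d * \int[leb]_t tent z e t.
  move=> d0; have /cvgrPdist_le/(_ _ d0)[r /= r0 rF] := cF z.
  near=> e; have er : e <= r by near: e; exact: nbhs_right_le.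
  have iFt := integrable_testM (continuous_locally_integrable cF)
    (@tent_continuous z e) (@tent_vanishes z e).
  have it := integrable_tent z e.
  have bd t : `|F z - F t| * tent z e t <= d * tent z e t.
    have [|ez] := ltP `|t - z| e; last by rewrite tent_out ?mulr0.
    move=> ze; apply: ler_wpM2r; first exact: tent_ge0.
    by apply: rF; rewrite /ball_ /= distrC (lt_le_trans ze).
  rewrite -!RintegralZl// -RintegralB//; last exact: integrable_scale.
  apply: (le_trans (le_normr_Rintegral _ _)) => //.
    apply: eq_integrable (integrableB _ iFt (integrable_scale (F z) _ it)) => //.
  apply: le_Rintegral => //.
  - apply: (@integrable_norm _ _ _ leb setT
      (fun t => F t * tent z e t - F z * tent z e t)).
    apply: eq_integrable (integrableB _ iFt (integrable_scale (F z) _ it)) => //.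
  - exact: integrable_scale.
  - move=> t _; apply: le_trans (bd t).
    by rewrite -mulrBl normrM distrC (ger0_norm (tent_ge0 z e t)).
apply/eqP; rewrite -subr_eq0 -normr_le0; apply/ler_addgt0Pr => d d0.
rewrite add0r.
have d2 : 0 < d / 2 by lra.
near (0 : R)^'+ => e.
have e0 : 0 < e by near: e; exact: nbhs_right_gt.
have := Rintegral_tent_gt0 x e0; have := Rintegral_tent_gt0 y e0.
have : `|\int[leb]_t (F t * tent x e t) - F x * \int[leb]_t tent x e t| <=
    d / 2 * \int[leb]_t tent x e t by near: e; exact: near_avg.
have : `|\int[leb]_t (F t * tent y e t) - F y * \int[leb]_t tent y e t| <=
    d / 2 * \int[leb]_t tent y e t by near: e; exact: near_avg.
set Ix := \int[leb]_t tent x e t; set Iy := \int[leb]_t tent y e t.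
set Jx := \int[leb]_t (F t * tent x e t).
set Jy := \int[leb]_t (F t * tent y e t) => hy hx Iy0 Ix0.
have JI : Jx / Ix = Jy / Iy.
  pose psi t := tent x e t / Ix - tent y e t / Iy.
  have ctx := @tent_continuous x e; have cty := @tent_continuous y e.
  have cpsi : continuous psi.
    by move=> t; apply: cvgB; apply: cvgM => //;
      [exact: ctx|exact: cvg_cst|exact: cty|exact: cvg_cst].
  have psiV : vanishes_off (Num.max (`|x| + e) (`|y| + e)) psi.
    move=> t; rewrite gt_max => /andP[xt yt].
    by rewrite /psi !tent_vanishes// !mul0r subrr.
  have ix := integrable_tent x e; have iy := integrable_tent y e.
  have psi0 : \int[leb]_t psi t = 0.
    rewrite RintegralB//; [|exact: integrable_scaler..].
    by rewrite !RintegralZr// !divff ?subrr// gt_eqF.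
  have [phi [tp phi']] := mean_zero_test cpsi psiV psi0.
  have := hF phi tp; rewrite phi' /psi.
  have lF := continuous_locally_integrable cF.
  have iFx := integrable_testM lF ctx (@tent_vanishes x e).
  have iFy := integrable_testM lF cty (@tent_vanishes y e).
  under eq_Rintegral do rewrite mulrBr !mulrA.
  rewrite RintegralB//; [|exact: integrable_scaler..].
  by rewrite !RintegralZr// => /eqP; rewrite subr_eq0 => /eqP.
have bnd J I z : 0 < I -> `|J - z * I| <= d / 2 * I -> `|J / I - z| <= d / 2.
  move=> I0 h; have -> : J / I - z = (J - z * I) / I.
    by rewrite mulrBl mulfK// gt_eqF.
  by rewrite normrM (gtr0_norm (x := I^-1)) ?invr_gt0// ler_pdivrMr.
have := bnd _ _ _ Iy0 hy; have := bnd _ _ _ Ix0 hx; rewrite JI.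
rewrite !ler_norml; lra.
Unshelve. all: by end_near. Qed.

(** By parts, the primitive of [f] integrates to zero against every [phi'], so it is constant;
    Lebesgue differentiation recovers [f] from it almost everywhere. *)
Lemma weak_derivative_unique0 f : locally_integrable setT f ->
  (forall phi, test_function phi -> \int[leb]_x (f x * phi x) = 0) ->
  {ae leb, forall x, f x = 0}.
Proof.
move=> lf hf; have PP := primitive0P lf.
have cP := primitive_continuous lf PP.
have [_ _ wP] := weak_derivative_primitive lf PP.
have Pc : forall x y, primitive0 f x = primitive0 f y.
  by apply: continuous_weakly_constant => // phi tp; rewrite wP// hf// oppr0.
have := lebesgue_differentiation lf.
apply: filterS; first exact: (ae_filter_ringOfSetsType leb).
move=> x fx; have x12 : x < x + 1 by lra.
have x01 : (BLeft (x - 1)%R < BRight x)%E by rewrite lte_fin; lra.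
have [_ <-] := FTC1_lebesgue_pt x12
  (@locally_integrable_segment _ _ (x - 1) (x + 1) lf) x01 fx.
rewrite derive1E (@near_eq_derive _ _ _ _ (cst 0)) ?derive_cst//.
have := primitive_nearE x lf PP; apply: filterS => y.
by rewrite (Pc y (x - 1)) -{1}[primitive0 f (x - 1)]addr0 => /addrI <-.
Qed.

(** Any test function becomes mean zero after subtracting a multiple of one fixed tent, and is then
    a derivative [phi']. The constant is therefore the average of [f] against that tent. *)
Lemma weakly_constant f : locally_integrable setT f ->
  (forall phi, test_function phi -> \int[leb]_x (f x * derive1 phi x) = 0) ->
  exists c, {ae leb, forall x, f x = c}.
Proof.
move=> lf hf; pose I := \int[leb]_t tent 0 1 t.
have I0 : 0 < I by apply: Rintegral_tent_gt0.
pose c := (\int[leb]_t (f t * tent 0 1 t)) / I; exists c.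
have lfc : locally_integrable setT (f \- cst c).
  by apply: locally_integrableB => //; exact: locally_integrable_cst.
suff : {ae leb, forall x, (f \- cst c) x = 0}.
  apply: filterS; first exact: (ae_filter_ringOfSetsType leb).
  by move=> x /= /eqP; rewrite subr_eq0 => /eqP.
apply: weak_derivative_unique0 => // psi tpsi.
have [A [A0 psiA _]] := test_function_vanishes tpsi.
have cpsi := test_function_continuous tpsi.
pose J := \int[leb]_t psi t.
pose chi t := psi t - J / I * tent 0 1 t.
have ct := @tent_continuous 0 1; have tV := @tent_vanishes 0 1.
have cchi : continuous chi.
  move=> t; apply: cvgB; first exact: cpsi.
  by apply: cvgM; [exact: cvg_cst|exact: ct].
have chiV : vanishes_off (Num.max A (`|0 : R| + 1)) chi.
  move=> t; rewrite gt_max => /andP[xt yt].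
  by rewrite /chi psiA// tV// mulr0 subrr.
have it := integrable_tent 0 1.
have ipsi : leb.-integrable setT (EFin \o psi).
  by apply: integrable_vanishes_off psiA; exact: continuous_locally_integrable.
have chi0 : \int[leb]_t chi t = 0.
  rewrite RintegralB//; last exact: integrable_scale.
  by rewrite RintegralZl// divfK ?subrr// gt_eqF.
have [phi [tp phi']] := mean_zero_test cchi chiV chi0.
have ifp := integrable_test lf tpsi.
have ift := integrable_testM lf ct tV.
have := hf phi tp; rewrite phi' /chi.
under eq_Rintegral do rewrite mulrBr mulrCA.
rewrite RintegralB//; last exact: integrable_scale.
rewrite RintegralZl// => /eqP; rewrite subr_eq0 => /eqP fE.
under eq_Rintegral do rewrite /= mulrBl.
rewrite RintegralB//; last exact: integrable_scale.
by rewrite RintegralZl// fE -/J /c; ring.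
Qed.

End weak.

(** * Exponential averages and the bounded flux for positive drift *)

Section exponential_average.
Variable R : realType.
Notation leb := (@lebesgue_measure R).
Implicit Types (f g h k u phi F : R -> R) (A a b c x y z om : R).

Lemma RintegralN d (T : measurableType d) (m : {measure set T -> \bar R})
    (D : set T) (v : T -> R) : measurable D -> m.-integrable D (EFin \o v) ->
  \int[m]_(t in D) (- v t) = - \int[m]_(t in D) v t.
Proof.
move=> mD iv; under eq_Rintegral do rewrite -mulN1r.
by rewrite RintegralZl// mulN1r.
Qed.

(** [F] is tested against [u * phi], which is again a test function. *)
Lemma weak_derivativeM F f u : weak_derivative F f ->
  (forall x, derivable u x 1) -> continuous (derive1 u) ->
  weak_derivative (fun x => u x * F x)
                  (fun x => derive1 u x * F x + u x * f x).
Proof.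
move=> [lF lf wF] du cu'; have cu := derivable_continuous du.
have luF : locally_integrable setT (fun x => u x * F x).
  by apply: locally_integrableM => //;
    [exact: continuous_measurable_fun|exact: continuous_locally_bounded].
have luf : locally_integrable setT (fun x => u x * f x).
  by apply: locally_integrableM => //;
    [exact: continuous_measurable_fun|exact: continuous_locally_bounded].
have lu'F : locally_integrable setT (fun x => derive1 u x * F x).
  by apply: locally_integrableM => //;
    [exact: continuous_measurable_fun|exact: continuous_locally_bounded].
split => //; first exact: locally_integrableD.
move=> phi tp; have [A [A0 pA _]] := test_function_vanishes tp.
have [dp cp' _] := tp; have cp := test_function_continuous tp.
have dup x : derivable (u * phi) x 1 by exact: derivableM.
have dupE : derive1 (u * phi) =
    (fun x => derive1 u x * phi x + u x * derive1 phi x).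
  apply/funext => x; rewrite !derive1E deriveM//= /GRing.scale/=; ring.
have tup : test_function (u * phi).
  apply: (@test_functionP _ _ A) => //.
    rewrite dupE => x; apply: cvgD; apply: cvgM;
      [exact: cu'|exact: cp|exact: cu|exact: cp'].
  by move=> x /pA pAx; rewrite -[LHS]/(u x * phi x) pAx mulr0.
have i1 := integrable_derive_test luF tp.
have i2 := integrable_test lu'F tp.
have i3 := integrable_test luf tp.
have := wF _ tup; rewrite dupE.
rewrite (@eq_Rintegral _ _ _ leb setT
  (fun x => derive1 u x * F x * phi x + u x * F x * derive1 phi x)); last first.
  by move=> x _ /=; ring.
rewrite RintegralD// => E.
rewrite [in RHS](@eq_Rintegral _ _ _ leb setT
  (fun x => derive1 u x * F x * phi x + u x * f x * phi x)); last first.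
  by move=> x _ /=; ring.
rewrite RintegralD//.
have : \int[leb]_x (f x * (u * phi) x) = \int[leb]_x (u x * f x * phi x).
  by apply: eq_Rintegral => x _; rewrite -[(u * phi) x]/(u x * phi x) mulrCA mulrA.
by move=> <-; lra.
Qed.

Definition expker om y : R := om * expR (- (om * y)).

Lemma expker_ge0 om y : 0 < om -> 0 <= expker om y.
Proof. by move=> om0; rewrite mulr_ge0 ?expR_ge0// ltW. Qed.

Lemma expker_continuous om : continuous (expker om).
Proof.
move=> x; apply: cvgM; first exact: cvg_cst.
apply: continuous_comp; last exact: continuous_expR.
by apply: cvgN; apply: cvgM; [exact: cvg_cst|exact: cvg_id].
Qed.

Lemma integral_expker om x : 0 < om ->
  (\int[leb]_(y in `[x, +oo[) (expker om y)%:E = (expR (- (om * x)))%:E)%E.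
Proof.
move=> om0; pose F y := - expR (- (om * y)).
have dF y : is_derive y 1 F (expker om y).
  rewrite /F /expker; apply: is_derive_eq.
  rewrite /GRing.scale/=; ring.
rewrite (@ge0_continuous_FTC2y _ (expker om) F x 0) //.
- by rewrite -EFinB sub0r opprK.
- by move=> y _; exact: expker_ge0.
- exact/continuous_subspaceT/expker_continuous.
- rewrite -oppr0; apply: cvgN.
  rewrite (_ : (fun y => expR (- (om * y))) =
    (fun z => expR (- z)) \o (fun z => om * z))//.
  apply: (@cvg_comp _ _ _ _ _ _ (pinfty_nbhs R)); last exact: cvgr_expR.
  exact: gt0_cvgMry.
- apply: cvg_at_right_filter; apply: derivable_continuous => y.
  by case: (dF y).
- by move=> y _; rewrite derive1E; case: (dF y).
Qed.

Lemma integrable_expker om x : 0 < om ->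
  leb.-integrable `[x, +oo[ (EFin \o expker om).
Proof.
move=> om0; apply/integrableP; split.
  apply/measurable_EFinP; apply: measurable_funTS.
  by apply: continuous_measurable_fun; exact: expker_continuous.
apply: (@le_lt_trans _ _ (\int[leb]_(y in `[x, +oo[) (expker om y)%:E)%E).
  rewrite le_eqVlt; apply/orP; left; apply/eqP; apply: eq_integral.
  by move=> y _ /=; rewrite ger0_norm// expker_ge0.
by rewrite integral_expker// ltry.
Qed.

(** The bounded solution of [v' = om * (v - k)]. The factor [exp (om x)] is kept outside so that the
    derivative comes from the product rule. *)
Definition expavg om k x :=
  expR (om * x) * \int[leb]_(y in `[x, +oo[) (expker om y * k y).

Lemma integrable_expkerM om k c x : 0 < om -> measurable_fun setT k ->
  (forall y, `|k y| <= c) ->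
  leb.-integrable `[x, +oo[ (EFin \o (fun y => expker om y * k y)).
Proof.
move=> om0 mk kc; apply: (integrable_boundedM (c := c)) => //.
  exact: measurable_funTS.
exact: integrable_expker.
Qed.

Lemma expavg_cst om c x : 0 < om -> expavg om (cst c) x = c.
Proof.
move=> om0; rewrite /expavg RintegralZr//; last exact: integrable_expker.
by rewrite /Rintegral integral_expker//= mulrA -expRD subrr expR0 mul1r.
Qed.

Lemma le_expavg om k1 k2 c x : 0 < om ->
  measurable_fun setT k1 -> (forall y, `|k1 y| <= c) ->
  measurable_fun setT k2 -> (forall y, `|k2 y| <= c) ->
  (forall y, k1 y <= k2 y) -> expavg om k1 x <= expavg om k2 x.
Proof.
move=> om0 mk1 k1c mk2 k2c k12; rewrite ler_wpM2l ?expR_ge0//.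
apply: le_Rintegral => //; [exact: integrable_expkerM k1c|
  exact: integrable_expkerM k2c|].
by move=> y _; rewrite ler_wpM2l// expker_ge0.
Qed.

Lemma norm_between m M y : m <= y <= M -> `|y| <= `|m| + `|M|.
Proof.
move=> /andP[my yM]; rewrite ler_norml; apply/andP; split.
  by have := ler_norm (- m); rewrite normrN; have := normr_ge0 M; lra.
by have := ler_norm M; have := normr_ge0 m; lra.
Qed.

Lemma expavg_bounds om k m M x : 0 < om -> measurable_fun setT k ->
  (forall y, m <= k y <= M) -> m <= expavg om k x <= M.
Proof.
move=> om0 mk kmM; pose c := `|m| + `|M|.
have cm : `|m| <= c by rewrite lerDl.
have cM : `|M| <= c by rewrite lerDr.
have kc y : `|k y| <= c by apply: norm_between; exact: kmM.
apply/andP; split.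
  rewrite -[leLHS](expavg_cst m x om0); apply: (@le_expavg _ _ _ c) => // y.
  by case/andP: (kmM y).
rewrite -[leRHS](expavg_cst M x om0); apply: (@le_expavg _ _ _ c) => // y.
by case/andP: (kmM y).
Qed.

Lemma expavg_weak_derivative om k c : 0 < om -> measurable_fun setT k ->
  (forall y, `|k y| <= c) ->
  continuous (expavg om k) /\
  weak_derivative (expavg om k) (fun x => om * (expavg om k x - k x)).
Proof.
move=> om0 mk kc.
pose K x := \int[leb]_(y in `[x, +oo[) (expker om y * k y).
pose E x : R := expR (om * x).
have lk : locally_integrable setT k by exact: bounded_locally_integrable kc.
have lEk : locally_integrable setT (fun y => - (expker om y * k y)).
  apply/locally_integrableN/locally_integrableM => //.
    by apply: continuous_measurable_fun; exact: expker_continuous.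
  by apply: continuous_locally_bounded; exact: expker_continuous.
(* The variable is the lower end of the tail integral, hence the minus sign. *)
have PK : primitive_of K (fun y => - (expker om y * k y)).
  move=> x y xy; rewrite /K.
  have iK := integrable_expkerM x om0 mk kc.
  rewrite RintegralN//; last first.
    by apply: integrableS iK => //; exact: subset_itvl.
  have := @Rintegral_itvB R _ (BLeft x) +oo%O y iK.
  rewrite bnd_simp => /(_ xy isT).
  rewrite Rintegral_itv_obnd_cbnd; last first.
    apply: integrableS (integrable_expkerM y om0 mk kc) => //.
    by apply: subset_itvr; rewrite bnd_simp.
  by move=> <-; lra.
have cK := primitive_continuous lEk PK.
have dE x : derivable E x 1 /\ derive1 E x = om * E x.
  have : is_derive x 1 E (om * E x).
    by rewrite /E; apply: is_derive_eq; rewrite /GRing.scale/=; ring.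
  by case=> ? <-; rewrite derive1E.
have cE : continuous E by apply: derivable_continuous => x; case: (dE x).
have E'E : derive1 E = (fun x => om * E x).
  by apply/funext => x; case: (dE x).
split; first by move=> x; apply: cvgM; [exact: cE|exact: cK].
have cE' : continuous (derive1 E).
  by rewrite E'E => x; apply: cvgM; [exact: cvg_cst|exact: cE].
have := weak_derivativeM (weak_derivative_primitive lEk PK)
  (fun x => (dE x).1) cE'.
rewrite E'E; congr (weak_derivative _ _).
apply/funext => x; rewrite /expavg -/(K x) -/(E x) /expker.
have -> : expR (- (om * x)) = (E x)^-1 by rewrite expRN.
have : E x != 0 by rewrite gt_eqF// expR_gt0.
by move=> E0; field.
Qed.

Lemma expavg_cvg om (k_ : nat -> R -> R) k c x : 0 < om ->
  (forall n, measurable_fun setT (k_ n)) ->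
  (forall n y, `|k_ n y| <= c) ->
  (forall y, k_ n y @[n --> \oo] --> k y) ->
  expavg om (k_ n) x @[n --> \oo] --> expavg om k x.
Proof.
move=> om0 mk_ k_c k_k.
have kc y : `|k y| <= c.
  by apply: (cvgr_to_le (cvg_norm (k_k y))); apply: nearW => n; exact: k_c.
have mk : measurable_fun setT k.
  by apply: measurable_fun_cvg => [n|y _]; [exact: mk_|exact: k_k].
apply: cvgM; first exact: cvg_cst.
apply: fine_cvg; rewrite fineK; last first.
  by apply: integrable_fin_num => //; exact: integrable_expkerM kc.
apply: (@dominated_cvg _ _ _ leb _ _ _ _ (EFin \o (fun y => expker om y * c))).
- by [].
- move=> n; apply/measurable_EFinP; apply: measurable_funTS.
  apply: measurable_funM; last exact: mk_.
  by apply: continuous_measurable_fun; exact: expker_continuous.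
- move=> y _; apply: cvg_EFin; first by apply: nearW.
  by apply: cvgM; [exact: cvg_cst|exact: k_k].
- by [].
- apply: (@integrable_expkerM _ (cst c) `|c|) => //.
- move=> n y _; rewrite /= lee_fin normrM ger0_norm ?expker_ge0//.
  by rewrite ler_wpM2l// expker_ge0.
Qed.

(** The map [q] below is chosen so that [om * (h - q h) = om / lam * (b * h - nu)]; a fixed point of
    [expavg om \o q] thus satisfies the equation. Values stay below [M] because [nu + (lam - b) * h
    <= M * b + (lam - b) * M = lam * M], and likewise above [m]. *)
Lemma bounded_solution om lam m M (nu b : R -> R) :
  0 < om -> 0 < lam -> m <= M ->
  measurable_fun setT nu -> measurable_fun setT b ->
  (forall x, 0 <= b x <= lam) -> (forall x, m * b x <= nu x <= M * b x) ->
  exists h, [/\ continuous h, forall x, m <= h x <= M &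
    weak_derivative h (fun x => om / lam * (b x * h x - nu x))].
Proof.
move=> om0 lam0 mM mnu mb b_lam nu_mM.
pose q h x := (nu x + (lam - b x) * h x) / lam.
have mq h : measurable_fun setT h -> measurable_fun setT (q h).
  move=> mh; apply: measurable_funM => //; apply: measurable_funD => //.
  by apply: measurable_funM => //; exact: measurable_funB.
have qb h : (forall x, m <= h x <= M) -> forall x, m <= q h x <= M.
  move=> hb x; have := hb x; have := b_lam x; have := nu_mM x.
  move=> /andP[? ?] /andP[? ?] /andP[? ?].
  by rewrite /q ler_pdivlMr// ler_pdivrMr//; apply/andP; split; nra.
have q_le h1 h2 x : h1 x <= h2 x -> q h1 x <= q h2 x.
  move=> h12; rewrite ler_pM2r ?invr_gt0// lerD2l ler_wpM2l// subr_ge0.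
  by have /andP[] := b_lam x.
(* Starting at the upper barrier makes the first step downward; monotonicity of the map then
   propagates the decrease. *)
pose h_ := fix h_ n := if n is n'.+1 then expavg om (q (h_ n')) else cst M.
have h_P n : measurable_fun setT (h_ n) /\ forall x, m <= h_ n x <= M.
  elim: n => [|n [mhn hnb]]; first by split=> [|x]; rewrite /= ?mM ?lexx.
  split; last by move=> x; apply: expavg_bounds => //; [exact: mq|exact: qb].
  apply: continuous_measurable_fun.
  have := @expavg_weak_derivative om (q (h_ n)) (`|m| + `|M|) om0 (mq _ mhn).
  by case=> // x; apply: norm_between; exact: qb.
have mh n := (h_P n).1; have hb n := (h_P n).2.
have qc n y : `|q (h_ n) y| <= `|m| + `|M|.
  by apply: norm_between; apply: qb; exact: hb.
have h_decr n x : h_ n.+1 x <= h_ n x.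
  elim: n x => [|n IH] x.
    by have := hb 1%N x => /andP[].
  exact: (le_expavg x om0 (mq _ (mh n.+1)) (qc n.+1) (mq _ (mh n)) (qc n)
    (fun y => q_le _ _ _ (IH y))).
pose h x := limn (fun n => h_ n x).
have h_cvg x : h_ n x @[n --> \oo] --> h x.
  apply: nonincreasing_is_cvgn.
    by apply/nonincreasing_seqP => n; exact: h_decr.
  by exists m => _ [n _ <-]; case/andP: (hb n x).
have hbd x : m <= h x <= M.
  apply/andP; split; [apply: (cvgr_to_ge (h_cvg x))|
    apply: (cvgr_to_le (h_cvg x))];
    by apply: nearW => n; case/andP: (hb n x).
have q_cvg y : q (h_ n) y @[n --> \oo] --> q h y.
  apply: cvgM; last exact: cvg_cst.
  apply: cvgD; first exact: cvg_cst.
  by apply: cvgM; [exact: cvg_cst|exact: h_cvg].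
have mhl : measurable_fun setT h.
  by apply: measurable_fun_cvg => [n|y _]; [exact: mh|exact: h_cvg].
(* Dominated convergence passes to the limit in the iteration; [h_ n.+1] has the same limit as
   [h_ n]. *)
have hE : h = expavg om (q h).
  apply/funext => x.
  have c1 := @expavg_cvg om (fun n => q (h_ n)) (q h) (`|m| + `|M|) x om0
    (fun n => mq _ (mh n)) qc q_cvg.
  have c2 : h_ n.+1 x @[n --> \oo] --> h x.
    by rewrite (cvg_shiftS (fun n => h_ n x)); exact: h_cvg.
  by rewrite -(cvg_lim (@Rhausdorff R) c2); apply: (cvg_lim (@Rhausdorff R) c1).
have [] := @expavg_weak_derivative om (q h) (`|m| + `|M|) om0 (mq _ mhl).
  by move=> x; apply: norm_between; exact: qb.
rewrite -hE => ch wh; exists h; split => //.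
move: wh; congr (weak_derivative _ _); apply/funext => x.
by rewrite /q; field; rewrite gt_eqF.
Qed.

End exponential_average.

(** * Growth for [u' = beta u], and integrals under reflection *)

Section growth.
Variable R : realType.
Notation leb := (@lebesgue_measure R).
Implicit Types (f g h k u phi F beta : R -> R) (A a b c d x y z om : R).

Lemma first_nonpos u x y : continuous u -> x <= y -> 0 < u x -> u y <= 0 ->
  exists z, [/\ x < z, u z <= 0 & forall t, x <= t < z -> 0 < u t].
Proof.
move=> cu xy ux uy; pose S := `[x, y] `&` u @^-1` [set t | t <= 0].
have cS : compact S.
  apply: compact_closedI; first exact: segment_compact.
  by apply: preimage_closed; [move=> t _; exact: cu|exact: closed_le].
have S0 : S !=set0 by exists y; split => //=; rewrite in_itv/= xy lexx.
have cid : {within S, continuous (id : R -> R)}.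
  by apply: continuous_subspaceT => t; exact: cvg_id.
have [z /set_mem[]] := compact_EVT_min S0 cS cid.
rewrite /= in_itv/= => /andP[xz zy] uz zmin; exists z; split => //.
  by rewrite lt_neqAle xz andbT; apply: contraTneq uz => <-; rewrite -ltNge.
move=> t /andP[xt tz]; rewrite ltNge; apply: contraL tz => ut.
rewrite -leNgt; have [ty|/ltW yt] := leP t y; last exact: le_trans yt.
by apply: zmin; rewrite inE; split => //=; rewrite in_itv/= xt.
Qed.

Section linear_ode.
Variables (u beta : R -> R) (c d : R).
Hypotheses (cu : continuous u) (mbeta : measurable_fun setT beta).
Hypotheses (c0 : 0 < c) (beta_bound : forall x, c <= beta x <= d).
Hypothesis u_primitive : primitive_of u (fun x => beta x * u x).

Let locally_integrable_betau : locally_integrable setT (fun x => beta x * u x).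
Proof.
apply: locally_integrableM => //; first exact: continuous_locally_integrable.
move=> K _; apply: (@boundedP _ _ (`|c| + `|d|)) => x.
exact/norm_between/beta_bound.
Qed.

(** Positivity cannot be lost to the right of [x]: up to the first nonpositive point [z] the
    integrand [beta * u] is positive, so [u z >= u x > 0]. The increment of [u] is then
    nonnegative. *)
Lemma linear_ode_le x y : 0 < u x -> x <= y -> u x <= u y.
Proof.
move=> ux xy; rewrite -subr_ge0; have [uy|uy] := ltP 0 (u y); last first.
  have [z [xz uz pos]] := first_nonpos cu xy ux uy.
  have : u z - u x >= 0.
    rewrite (u_primitive (ltW xz)) -Rintegral_itv_bndo_bndc; last first.
      apply: integrableS (locally_integrable_segment x z locally_integrable_betau) => //.
      exact: subset_itv_co_cc.
    apply: Rintegral_ge0 => t; rewrite /= in_itv/= => /pos ut.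
    by have /andP[cb _] := beta_bound t; rewrite mulr_ge0// ltW// (lt_le_trans c0).
  lra.
have [pos|] := pselect (forall t, x <= t <= y -> 0 < u t).
  rewrite (u_primitive xy); apply: Rintegral_ge0 => t; rewrite /= in_itv/=.
  move=> /pos ut; have /andP[cb _] := beta_bound t.
  by rewrite mulr_ge0// ltW// (lt_le_trans c0).
move=> /existsNP[t /not_implyP[/andP[xt ty] /negP]]; rewrite -leNgt => ut.
have [z [xz uz pos]] := first_nonpos cu xt ux ut.
have : u z - u x >= 0.
  rewrite (u_primitive (ltW xz)) -Rintegral_itv_bndo_bndc; last first.
    apply: integrableS (locally_integrable_segment x z locally_integrable_betau) => //.
    exact: subset_itv_co_cc.
  apply: Rintegral_ge0 => s; rewrite /= in_itv/= => /pos us.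
  by have /andP[cb _] := beta_bound s; rewrite mulr_ge0// ltW// (lt_le_trans c0).
lra.
Qed.

Lemma linear_ode_growth x y : 0 < u x -> x <= y ->
  u x + c * u x * (y - x) <= u y.
Proof.
move=> ux xy; rewrite -lerBrDl (u_primitive xy).
have -> : c * u x * (y - x) = \int[leb]_(t in `[x, y]) (cst (c * u x) t).
  rewrite Rintegral_cst//; congr (_ * _).
  have mE : lebesgue_measure `[x, y] = (y - x)%:E.
    rewrite lebesgue_measure_itv/= lte_fin; case: ltP => //.
    by move=> yx; rewrite (_ : y = x) ?subrr//; apply/eqP; rewrite eq_le xy yx.
  exact: (congr1 fine (esym mE)).
apply: le_Rintegral => //.
- exact/locally_integrable_segment/locally_integrable_cst.
- exact: locally_integrable_segment.
- move=> t; rewrite /= in_itv/= => /andP[xt ty].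
  have /andP[cb _] := beta_bound t.
  by apply: ler_pM => //; [exact: ltW|exact: ltW|exact: linear_ode_le].
Qed.

(** No exponential is required: the linear lower bound, applied on two consecutive intervals of
    length [s], already gives quadratic growth from a positive value, against the linear upper
    bound. *)
Lemma linear_ode_nonpos C : (forall x, `|u x| <= C * (1 + `|x|)) ->
  forall x, u x <= 0.
Proof.
move=> uC x; rewrite leNgt; apply/negP => ux.
have C0 : 0 <= C.
  have := uC 0; rewrite normr0 addr0 mulr1; exact: le_trans.
have key s : 0 < s -> c ^+ 2 * u x * s ^+ 2 <= C * (1 + `|x| + 2 * s).
  move=> s0; have xs : x <= x + s by lra.
  have h1 := linear_ode_growth ux xs.
  have us : 0 < u (x + s) by apply: lt_le_trans (linear_ode_le ux xs).
  have xss : x + s <= x + s + s by lra.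
  have h2 := linear_ode_growth us xss.
  have h3 := uC (x + s + s).
  have h4 : `|x + s + s| <= `|x| + 2 * s.
    rewrite -addrA (le_trans (ler_normD _ _))// lerD2l ger0_norm; lra.
  have h5 : C * (1 + `|x + s + s|) <= C * (1 + `|x| + 2 * s).
    by rewrite ler_wpM2l//; lra.
  have h6 := ler_norm (u (x + s + s)).
  have h7 : c * u x * s <= u (x + s) by move: h1; rewrite [x + s]addrC addrK; lra.
  have h8 : c * s * (c * u x * s) <= c * s * u (x + s).
    by rewrite ler_wpM2l// mulr_ge0// ltW.
  move: h2; rewrite [x + s + s]addrC addrK => h2.
  rewrite [s + (x + s)]addrC in h2.
  have -> : c ^+ 2 * u x * s ^+ 2 = c * s * (c * u x * s) by ring.
  have : c * u (x + s) * s <= u (x + s + s) by lra.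
  have -> : c * u (x + s) * s = c * s * u (x + s) by ring.
  lra.
pose q := c ^+ 2 * u x; have q0 : 0 < q by rewrite mulr_gt0// exprn_gt0.
pose D := C * (3 + `|x|); have D0 : 0 <= D by rewrite mulr_ge0//; have := normr_ge0 x; lra.
(* This choice gives [q * s = q + D], while [s >= 1] bounds the right side of [key] by [D * s]; so
   [(q + D) * s <= D * s], which is absurd. *)
pose s := 1 + D / q; have Dq : 0 <= D / q by rewrite divr_ge0// ltW.
have s1 : 1 <= s by rewrite /s; lra.
have s0 : 0 < s by lra.
have := key s s0; rewrite -/q.
have : C * (1 + `|x| + 2 * s) <= D * s.
  rewrite /D -mulrA ler_wpM2l//.
  have : `|x| * 1 <= `|x| * s by rewrite ler_wpM2l.
  lra.
have : q * s ^+ 2 = (q + D) * s.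
  by rewrite /s; field; rewrite gt_eqF.
move=> -> h1 h2; have : (q + D) * s <= D * s by lra.
rewrite ler_pM2r//; lra.
Qed.

End linear_ode.

(** The equation is linear, so the sign bound holds for both [u] and [\- u]. *)
Lemma linear_ode_eq0 u beta c d C : continuous u -> measurable_fun setT beta ->
  0 < c -> (forall x, c <= beta x <= d) ->
  primitive_of u (fun x => beta x * u x) ->
  (forall x, `|u x| <= C * (1 + `|x|)) -> forall x, u x = 0.
Proof.
move=> cu mb c0 bb up uC x; apply/eqP; rewrite eq_le.
rewrite (linear_ode_nonpos cu mb c0 bb up uC)/= -oppr_le0.
apply: (linear_ode_nonpos (u := \- u) _ mb c0 bb _ (C := C)).
- by move=> t; apply: cvgN; exact: cu.
- move=> y z yz /=; have lbu : locally_integrable setT (fun x => beta x * u x).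
    apply: locally_integrableM => //; first exact: continuous_locally_integrable.
    move=> K _; apply: (@boundedP _ _ (`|c| + `|d|)) => t.
    exact/norm_between/bb.
  under eq_Rintegral do rewrite mulrN.
  rewrite RintegralN//; last exact: locally_integrable_segment.
  by rewrite -up//; lra.
- by move=> t /=; rewrite normrN.
Qed.

(** The image of Lebesgue measure under negation is Lebesgue measure. *)
Lemma ge0_integral_oppr (f : R -> \bar R) : measurable_fun setT f ->
  (forall t, (0%E <= f t)%E) ->
  (\int[leb]_t f (- t)%R = \int[leb]_t f t)%E.
Proof.
move=> mf f0; pose opp := (-%R : measurableTypeR R -> measurableTypeR R).
have mopp : measurable_fun [set: measurableTypeR R] opp by exact: oppr_measurable.
have := @ge0_integral_pushforward _ _ _ _ _ opp mopp leb setT f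
  measurableT mf (fun y _ => f0 y).
rewrite preimage_setT => <-.
by apply: eq_measure_integral => A mA _; exact: lebesgue_measureN.
Qed.

Lemma Rintegral_oppr f : measurable_fun setT f ->
  \int[leb]_t f (- t) = \int[leb]_t f t.
Proof.
move=> mf; rewrite /Rintegral; congr fine; rewrite integralE [in RHS]integralE.
have mF : measurable_fun setT (EFin \o f) by exact/measurable_EFinP.
congr (_ - _)%E.
- rewrite -(ge0_integral_oppr (f := ((EFin \o f)^\+)%E))//.
    by apply: eq_integral => t _; rewrite !funeposE.
  exact: measurable_funepos.
- rewrite -(ge0_integral_oppr (f := ((EFin \o f)^\-)%E))//.
    by apply: eq_integral => t _; rewrite !funenegE.
  exact: measurable_funeneg.
Qed.

Lemma Rintegral_segment_oppr f x y : measurable_fun setT f ->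
  \int[leb]_(t in `[x, y]) f (- t) = \int[leb]_(t in `[- y, - x]) f t.
Proof.
move=> mf; rewrite Rintegral_mkcond [RHS]Rintegral_mkcond.
rewrite -[RHS]Rintegral_oppr; last first.
  by apply/(measurable_restrictT _ _).1 => //; exact: measurable_funTS.
apply: eq_Rintegral => t _; rewrite !patchE !mem_setE !in_itv/=.
by rewrite lerN2 lerNl opprK [(_ <= t) && _]andbC.
Qed.

End growth.

(** * The flux for any sign of the drift, and bounds on primitives *)

Section solutions.
Variable R : realType.
Notation leb := (@lebesgue_measure R).
Implicit Types (f g h u phi F S T nu a b beta : R -> R) (c d x y z om W : R).

(** [F] is tested against [phi (- x)], followed by the change of variable in each integral. *)
Lemma weak_derivative_oppr F f c : continuous F -> measurable_fun setT f ->
  (forall x, `|f x| <= c) -> weak_derivative F f ->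
  weak_derivative (fun x => F (- x)) (fun x => - f (- x)).
Proof.
move=> cF mf fc [lF lf wF].
have cFo : continuous (fun x => F (- x)).
  by move=> x; apply: continuous_comp; [exact: oppr_continuous|exact: cF].
have mfo : measurable_fun setT (fun x => f (- x)).
  by apply: measurableT_comp => //; exact: oppr_measurable.
split; first exact: continuous_locally_integrable.
  apply: (@bounded_locally_integrable _ _ c); first exact: measurable_funN.
  by move=> x; rewrite normrN.
move=> phi tp; have [A [A0 pA _]] := test_function_vanishes tp.
have [dp cp' _] := tp; have cp := test_function_continuous tp.
have dpo x : is_derive x 1 (fun x => phi (- x)) (- derive1 phi (- x)).
  have dphi : is_derive (- x) 1 phi (derive1 phi (- x)).
    by apply: DeriveDef; [exact: dp|rewrite derive1E].
  have dN : is_derive x 1 (-%R : R -> R) (-1) by apply: is_derive_eq.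
  by have := is_derive1_comp dphi dN; rewrite mulrN1.
have dpoE : derive1 (fun x => phi (- x)) = (fun x => - derive1 phi (- x)).
  by apply/funext => x; rewrite derive1E; case: (dpo x).
have tpo : test_function (fun x => phi (- x)).
  apply: (@test_functionP _ _ A).
  - by move=> x; case: (dpo x).
  - rewrite dpoE => x; apply: cvgN.
    by apply: continuous_comp; [exact: oppr_continuous|exact: cp'].
  - by move=> x Ax; rewrite pA// normrN.
have := wF _ tpo; rewrite dpoE => E.
rewrite -(@Rintegral_oppr _ (fun x => F (- x) * derive1 phi x)); last first.
  by apply: measurable_funM; exact: continuous_measurable_fun.
under eq_Rintegral do rewrite opprK.
have mphi := continuous_measurable_fun cp.
have mphi' := continuous_measurable_fun cp'.
rewrite -(@Rintegral_oppr _ (fun x => - f (- x) * phi x)); last first.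
  by apply: measurable_funM => //; exact: measurable_funN.
under [in RHS]eq_Rintegral do rewrite opprK mulNr.
rewrite RintegralN//; last exact: integrable_test lf tpo.
rewrite opprK -[RHS]opprK -E -RintegralN//; last first.
  have := integrable_derive_test (continuous_locally_integrable cF) tpo.
  by rewrite dpoE.
by apply: eq_Rintegral => x _; rewrite mulrN opprK.
Qed.

(** With [om = W * lam] the factor [om / lam] is the drift. For [W < 0] the positive case is applied
    to the reflected coefficients with drift [- W]; for [W = 0] the flux is a constant, taken to be
    [M]. *)
Lemma bounded_flux W lam m M nu b : 0 < lam -> m <= M ->
  measurable_fun setT nu -> measurable_fun setT b ->
  (forall x, 0 <= b x <= lam) -> (forall x, m * b x <= nu x <= M * b x) ->
  exists h, [/\ continuous h, forall x, m <= h x <= M &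
    weak_derivative h (fun x => W * (b x * h x - nu x))].
Proof.
move=> lam0 mM mnu mb b_lam nu_mM; have [W0|W0|->] := ltgtP W 0; last first.
- exists (cst M); split=> [x|x|]; first exact: cvg_cst.
    by rewrite /= mM lexx.
  have -> : (fun x => 0 * (b x * cst M x - nu x)) = cst 0 :> (R -> R).
    by apply/funext => x; rewrite mul0r.
  apply: weak_derivative_primitive; first exact: locally_integrable_cst.
  by move=> x y _; rewrite Rintegral_cst// mul0r subrr.
- have om0 : 0 < W * lam by rewrite mulr_gt0.
  have [h [ch hb]] := bounded_solution om0 lam0 mM mnu mb b_lam nu_mM.
  by rewrite mulfK ?gt_eqF// => wh; exists h.
- have om0 : 0 < - W * lam by rewrite mulr_gt0// oppr_gt0.
  have mo k : measurable_fun setT k -> measurable_fun setT (fun x : R => k (- x) : R).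
    by move=> mk; apply: measurableT_comp => //; exact: oppr_measurable.
  have [h [ch hb]] := bounded_solution om0 lam0 mM (mo _ mnu) (mo _ mb)
    (fun x => b_lam (- x)) (fun x => nu_mM (- x)).
  rewrite mulfK ?gt_eqF// => wh.
  have mh := continuous_measurable_fun ch.
  have mk : measurable_fun setT
      (fun x => - W * (b (- x) * h x - nu (- x))).
    apply: measurable_funM => //; apply: measurable_funB; last exact: mo.
    by apply: measurable_funM => //; exact: mo.
  (* Both [b * h] and [nu] lie between [m * b] and [M * b]. *)
  have kc x : `|- W * (b (- x) * h x - nu (- x))| <= `|W| * ((M - m) * lam).
    rewrite normrM normrN ler_wpM2l// ler_norml.
    have /andP[b0 bl] := b_lam (- x); have /andP[n1 n2] := nu_mM (- x).
    have /andP[h1 h2] := hb x.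
    have bh1 : m * b (- x) <= b (- x) * h x by rewrite mulrC ler_wpM2l.
    have bh2 : b (- x) * h x <= M * b (- x) by rewrite [leRHS]mulrC ler_wpM2l.
    have : (M - m) * b (- x) <= (M - m) * lam by rewrite ler_wpM2l// subr_ge0.
    rewrite mulrBl => ?; apply/andP; split; lra.
  exists (fun x => h (- x)); split.
  - by move=> x; apply: continuous_comp; [exact: oppr_continuous|exact: ch].
  - by move=> x; exact: hb.
  - move: (weak_derivative_oppr ch mk kc wh); congr (weak_derivative _ _).
    by apply/funext => x; rewrite opprK mulNr opprK.
Qed.

(** [F] and [primitive0 f] share a weak derivative, so their continuous difference is constant. *)
Lemma weak_derivative_primitive_of F f : continuous F -> weak_derivative F f ->
  primitive_of F f.
Proof.
move=> cF [lF lf wF]; have PP := primitive0P lf.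
have [lP _ wP] := weak_derivative_primitive lf PP.
have cP := primitive_continuous lf PP.
have := @continuous_weakly_constant _ (F \- primitive0 f).
move=> /(_ _ _)/wrap[]; first by move=> x; apply: cvgB; [exact: cF|exact: cP].
  move=> phi tp; under eq_Rintegral do rewrite mulrBl.
  rewrite RintegralB//; [|exact: integrable_derive_test..].
  by rewrite wF// wP// subrr.
by move=> FP x y xy; rewrite -PP//; have := FP x y; rewrite /=; lra.
Qed.

Lemma weak_derivative_unique F f g : weak_derivative F f ->
  weak_derivative F g -> {ae leb, forall x, f x = g x}.
Proof.
move=> [lF lf wf] [_ lg wg].
have : {ae leb, forall x, (f \- g) x = 0}.
  apply: weak_derivative_unique0; first exact: locally_integrableB.
  move=> phi tp; under eq_Rintegral do rewrite mulrBl.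
  rewrite RintegralB//; [|exact: integrable_test..].
  by apply/eqP; rewrite subr_eq0 -eqr_opp -wf// -wg.
apply: filterS; first exact: (ae_filter_ringOfSetsType leb).
by move=> x /= /eqP; rewrite subr_eq0 => /eqP.
Qed.

Lemma primitive_between F f m M : measurable_fun setT f ->
  (forall x, m <= f x <= M) -> primitive_of F f ->
  forall x y, x <= y -> m * (y - x) <= F y - F x <= M * (y - x).
Proof.
move=> mf fmM Ff x y xy; rewrite Ff//.
have lf : locally_integrable setT f.
  by apply: (@bounded_locally_integrable _ _ (`|m| + `|M|)) => // t; apply: norm_between.
have cstE c : c * (y - x) = \int[leb]_(t in `[x, y]) (cst c t).
  rewrite Rintegral_cst//; congr (_ * _).
  have mE : lebesgue_measure `[x, y] = (y - x)%:E.
    rewrite lebesgue_measure_itv/= lte_fin; case: ltP => //.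
    by move=> yx; rewrite (_ : y = x) ?subrr//; apply/eqP; rewrite eq_le xy yx.
  exact: (congr1 fine (esym mE)).
rewrite !cstE; apply/andP; split; apply: le_Rintegral => //;
  try exact/locally_integrable_segment/locally_integrable_cst;
  try exact: locally_integrable_segment; by move=> t _; case/andP: (fmM t).
Qed.

(** Every weak derivative agrees almost everywhere with [f]; a classical derivative is a limit of
    difference quotients, all of which lie in [[m, M]]. *)
Lemma primitive_derivative_between F f m M : measurable_fun setT f ->
  (forall x, m <= f x <= M) -> primitive_of F f -> derivative_between m M F.
Proof.
move=> mf fmM Ff; have Fb := primitive_between mf fmM Ff.
have lf : locally_integrable setT f.
  by apply: (@bounded_locally_integrable _ _ (`|m| + `|M|)) => // t; apply: norm_between.
split=> [g wg|x dF].
  have := weak_derivative_unique (weak_derivative_primitive lf Ff) wg.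
  apply: filterS; first exact: (ae_filter_ringOfSetsType leb).
  by move=> x <-; exact: fmM.
have qb e : e != 0 -> m <= e^-1 * (F (e + x) - F x) <= M.
  move=> e0; have [hn|hp|/eqP] := ltgtP e 0; last by rewrite (negbTE e0).
    have hx : e + x <= x by lra.
    have /andP[h1 h2] := Fb _ _ hx.
    have -> : e^-1 * (F (e + x) - F x) = (F x - F (e + x)) / (- e).
      by rewrite invrN; ring.
    have hN : 0 < - e by lra.
    by rewrite ler_pdivlMr// ler_pdivrMr//; apply/andP; split; lra.
  have hx : x <= e + x by lra.
  have /andP[h1 h2] := Fb _ _ hx.
  by rewrite mulrC ler_pdivlMr// ler_pdivrMr//; apply/andP; split; lra.
rewrite derive1E /derive; set q := (fun e => _).
have cq : cvg (q @ 0^') by exact: dF.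
have nq : \forall e \near 0^', m <= q e <= M.
  near=> e; rewrite /q /= /GRing.scale /= mulr1; apply: qb.
  by near: e; exact: nbhs_dnbhs_neq.
by apply/andP; split; [apply: limr_ge => //|apply: limr_le => //];
  move: nq; apply: filterS => h /andP[].
Unshelve. all: by end_near. Qed.

Lemma primitive_at_most_linear F f c : measurable_fun setT f ->
  (forall x, `|f x| <= c) -> primitive_of F f -> F 0 = 0 -> at_most_linear F.
Proof.
move=> mf fc Ff F0; have fcc x : - c <= f x <= c by rewrite -ler_norml.
have Fb := primitive_between mf fcc Ff.
exists c => x x0; rewrite normrM normfV normr_id ler_pdivrMr ?normr_gt0//.
have [xp|xn] := leP 0 x.
  by have := Fb _ _ xp; rewrite F0 !subr0 (ger0_norm xp) ler_norml mulNr.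
have := Fb _ _ (ltW xn); rewrite F0 !sub0r (ltr0_norm xn) ler_norml.
by rewrite mulNr lerN2 lerNl => /andP[-> ->].
Qed.

End solutions.

(** * Existence and uniqueness of the weak solution *)

Section final.
Variable R : realType.
Notation leb := (@lebesgue_measure R).
Implicit Types (f g h u phi F S T nu a b beta : R -> R) (c d x y z om W m M mu : R).

Lemma ae_eq_Rintegral f g : measurable_fun setT f -> measurable_fun setT g ->
  {ae leb, forall x, f x = g x} -> \int[leb]_x f x = \int[leb]_x g x.
Proof.
move=> mf mg fg; congr fine; apply: ae_eq_integral => //;
  [exact/measurable_EFinP|exact/measurable_EFinP|].
by apply: filterS fg => [|x -> //]; exact: (ae_filter_ringOfSetsType leb).
Qed.

(** This allows the coefficients to be modified on null sets, so that their bounds hold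
    everywhere. *)
Lemma weak_solution_ae nu nu' a a' W T :
  measurable_fun setT nu -> measurable_fun setT nu' ->
  measurable_fun setT a -> measurable_fun setT a' ->
  {ae leb, forall x, nu x = nu' x} -> {ae leb, forall x, a x = a' x} ->
  weak_solution nu a W T -> weak_solution nu' a' W T.
Proof.
move=> mnu mnu' ma ma' nuE aE [cT [g wg eqT]]; split=> //; exists g => // phi tp.
have mg : measurable_fun setT g by case: wg => _ [].
have mphi := continuous_measurable_fun (test_function_continuous tp).
have mphi' : measurable_fun setT (derive1 phi).
  by case: tp => _ cp' _; exact: continuous_measurable_fun.
have -> : \int[leb]_x (W * nu' x * phi x) = \int[leb]_x (W * nu x * phi x).
  apply: ae_eq_Rintegral.
  - by do 2 apply: measurable_funM => //.
  - by do 2 apply: measurable_funM => //.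
  - apply: filterS nuE => [|x -> //]; exact: (ae_filter_ringOfSetsType leb).
rewrite -eqT//; apply: ae_eq_Rintegral.
- apply: measurable_funD; last by do 2 apply: measurable_funM => //.
  by do 3 apply: measurable_funM => //.
- apply: measurable_funD; last by do 2 apply: measurable_funM => //.
  by do 3 apply: measurable_funM => //.
- apply: filterS2 nuE aE => [|x -> -> //]; exact: (ae_filter_ringOfSetsType leb).
Qed.

Lemma betweenM mu i j x y : 0 < mu ->
  (1 / mu) ^+ i <= x <= mu ^+ i -> (1 / mu) ^+ j <= y <= mu ^+ j ->
  (1 / mu) ^+ (i + j) <= x * y <= mu ^+ (i + j).
Proof.
move=> mu0 /andP[ix xi] /andP[jy yj]; rewrite !exprD.
have p0 n : 0 <= (1 / mu) ^+ n by rewrite exprn_ge0// divr_ge0// ltW.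
by rewrite !ler_pM// ?(le_trans (p0 i) ix)// (le_trans (p0 j) jy).
Qed.

Lemma betweenV mu x : 0 < mu -> 1 / mu <= x <= mu -> 1 / mu <= x^-1 <= mu.
Proof.
move=> mu0 /andP[mx xm].
have x0 : 0 < x by apply: lt_le_trans mx; rewrite divr_gt0.
rewrite div1r lef_pV2 ?posrE// xm/= -(invrK mu) lef_pV2 ?posrE ?invr_gt0//.
by rewrite -div1r.
Qed.

(** Above [c] the inverse coincides with [1 / max (c, y)], which is continuous on the whole line. *)
Lemma measurable_inv f c : 0 < c -> measurable_fun setT f ->
  (forall x, c <= f x) -> measurable_fun setT (fun x => (f x)^-1).
Proof.
move=> c0 mf fc.
have cmax : continuous (fun x : R => Num.max c x).
  move=> x; have c1 : {for x, continuous (cst c : R -> R^o)} by exact: cvg_cst.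
  have c2 : {for x, continuous (id : R -> R^o)} by exact: cvg_id.
  exact: (continuous_max c1 c2).
have cinv : continuous (fun x : R => (Num.max c x)^-1).
  by move=> x; apply: cvgV; [rewrite gt_eqF// lt_max c0|exact: cmax].
have -> : (fun x => (f x)^-1) = (fun x => (Num.max c x)^-1) \o f.
  by apply/funext => x /=; rewrite max_r.
by apply: measurableT_comp => //; exact: continuous_measurable_fun.
Qed.

Lemma exists_weak_solution W mu nu a : 0 < mu -> 1 <= mu ->
  measurable_fun setT nu -> measurable_fun setT a ->
  (forall x, 1 / mu <= nu x <= mu) -> (forall x, 1 / mu <= a x <= mu) ->
  exists T, [/\ weak_solution nu a W T, T 0 = 0, at_most_linear T &
    derivative_between (1 / mu ^+ 5) (mu ^+ 5) T].
Proof.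
move=> mu0 mu1 mnu ma nub ab.
have pos x : 1 / mu <= x -> 0 < x by apply: lt_le_trans; rewrite divr_gt0.
have nu0 x : 0 < nu x by apply: pos; case/andP: (nub x).
have a0 x : 0 < a x by apply: pos; case/andP: (ab x).
pose b x := (nu x)^-1 * (a x)^-1.
have b2 x : (1 / mu) ^+ 2 <= b x <= mu ^+ 2.
  by apply: (@betweenM _ 1 1) => //; rewrite !expr1; exact: betweenV.
have mb : measurable_fun setT b.
  by apply: measurable_funM; apply: (@measurable_inv _ (1 / mu)) => //;
    rewrite ?divr_gt0// => x; [case/andP: (nub x)|case/andP: (ab x)].
have b0 x : 0 < b x by rewrite mulr_gt0// invr_gt0.
have b_lam x : 0 <= b x <= mu ^+ 2 by rewrite ltW//=; case/andP: (b2 x).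
have nu_mM x : (1 / mu) ^+ 3 * b x <= nu x <= mu ^+ 3 * b x.
  have : (1 / mu) ^+ (1 + 1 + 1) <= nu x / b x <= mu ^+ (1 + 1 + 1).
    have -> : nu x / b x = nu x * nu x * a x.
      by rewrite /b invfM !invrK mulrA.
    by do 2 apply: betweenM => //; rewrite expr1.
  by rewrite ler_pdivlMr// ler_pdivrMr.
have lam0 : 0 < mu ^+ 2 by rewrite exprn_gt0.
have mM : (1 / mu) ^+ 3 <= mu ^+ 3.
  apply: lerXn2r; rewrite ?nnegrE ?divr_ge0 ?(ltW mu0)//.
  by rewrite ler_pdivrMr//; nra.
have [h [ch hb wh]] := bounded_flux W lam0 mM mnu mb b_lam nu_mM.
pose g x := b x * h x.
have mg : measurable_fun setT g.
  by apply: measurable_funM => //; exact: continuous_measurable_fun.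
have gb x : 1 / mu ^+ 5 <= g x <= mu ^+ 5.
  have -> : 1 / mu ^+ 5 = (1 / mu) ^+ 5 by rewrite !div1r exprVn.
  exact: (@betweenM _ 2 3).
have gc x : `|g x| <= `|1 / mu ^+ 5| + `|mu ^+ 5| by exact/norm_between/gb.
have lg : locally_integrable setT g by exact: bounded_locally_integrable gc.
have Pg := primitive0P lg.
exists (primitive0 g); split.
- split; first exact: primitive_continuous Pg.
  exists g; first exact: weak_derivative_primitive.
  move=> phi tp; have [lh lh' wh'] := wh.
  have lnu : locally_integrable setT nu.
    by apply: (@bounded_locally_integrable _ _ (`|1 / mu| + `|mu|)) => // x;
      exact/norm_between/nub.
  have i1 := integrable_derive_test lh tp.
  have i2 := integrable_test lg tp.
  have i3 := integrable_test lnu tp.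
  (* Since [a nu g = h], the flux equation turns the first term into [- W] times the integral of
     [(g - nu) * phi]; the terms in [g] cancel. *)
  rewrite (@eq_Rintegral _ _ _ leb setT
    (fun x => h x * derive1 phi x + W * (g x * phi x))); last first.
    move=> x _; congr (_ * _ + _); last by rewrite -mulrA.
    by rewrite /g /b; field; rewrite (gt_eqF (a0 x)) (gt_eqF (nu0 x)).
  rewrite RintegralD//; last exact: integrable_scale.
  rewrite wh'// RintegralZl//.
  under [in RHS]eq_Rintegral do rewrite -mulrA.
  rewrite RintegralZl//.
  rewrite (@eq_Rintegral _ _ _ leb setT
    (fun x => W * (g x * phi x) - W * (nu x * phi x))); last first.
    by move=> x _; rewrite /g; ring.
  rewrite RintegralB//; [|exact: integrable_scale..].
  by rewrite !RintegralZl//; lra.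
- exact: primitive0_0.
- by apply: (primitive_at_most_linear mg gc Pg); exact: primitive0_0.
- exact: primitive_derivative_between mg gb Pg.
Qed.

Lemma weak_derivativeB F G f g : weak_derivative F f ->
  weak_derivative G g -> weak_derivative (F \- G) (f \- g).
Proof.
move=> [lF lf wF] [lG lg wG]; split; [exact: locally_integrableB..|].
move=> phi tp; under eq_Rintegral do rewrite mulrBl.
rewrite RintegralB//; [|exact: integrable_derive_test..].
under [in RHS]eq_Rintegral do rewrite mulrBl.
by rewrite RintegralB//; [rewrite wF// wG//; lra|exact: integrable_test..].
Qed.

(** For negative [beta] growth occurs to the left: [u (- x)] solves the equation with the positive
    coefficient [- beta (- x)]. *)
Lemma linear_ode_eq0N u beta c d C : continuous u -> measurable_fun setT beta ->
  0 < c -> (forall x, c <= - beta x <= d) ->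
  primitive_of u (fun x => beta x * u x) ->
  (forall x, `|u x| <= C * (1 + `|x|)) -> forall x, u x = 0.
Proof.
move=> cu mb c0 bb up uC x.
have mbo : measurable_fun setT (fun x => - beta (- x)).
  have mbo' : measurable_fun setT (fun x : R => beta (- x)).
    by apply: measurableT_comp => //; exact: oppr_measurable.
  exact: measurable_funN.
rewrite -(opprK x); apply: (@linear_ode_eq0 _ (fun x => u (- x))
  (fun x => - beta (- x)) c d C) => //.
- by move=> t; apply: continuous_comp; [exact: oppr_continuous|exact: cu].
- move=> y z yz.
  have lbu : locally_integrable setT (fun x => beta x * u x).
    apply: locally_integrableM => //; first exact: continuous_locally_integrable.
    move=> K _; apply: (@boundedP _ _ (`|c| + `|d|)) => t.
    by rewrite -normrN; exact/norm_between/bb.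
  have yz' : - z <= - y by rewrite lerN2.
  have := up _ _ yz'; rewrite -Rintegral_segment_oppr; last by case: lbu.
  move=> E; rewrite -opprB E -mulN1r -RintegralZl//; last first.
    apply: locally_integrable_segment; apply: locally_integrableM.
    - by apply: continuous_locally_integrable => t;
        apply: continuous_comp; [exact: oppr_continuous|exact: cu].
    - by apply: measurableT_comp => //; exact: oppr_measurable.
    - move=> K _; apply: (@boundedP _ _ (`|c| + `|d|)) => t.
      by rewrite -normrN; exact/norm_between/bb.
  by apply: eq_Rintegral => t _; rewrite mulN1r mulNr.
- by move=> t; rewrite -(normrN t); exact: uC.
Qed.

Lemma at_most_linear_norm F c : F 0 = 0 ->
  (forall x, x != 0 -> `|F x / `|x| | <= c) -> forall x, `|F x| <= `|c| * `|x|.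
Proof.
move=> F0 Fc x; have [->|x0] := eqVneq x 0; first by rewrite F0 !normr0 mulr0.
have := Fc x x0; rewrite normrM normfV normr_id ler_pdivrMr ?normr_gt0// => h.
by apply: le_trans h _; rewrite ler_wpM2r// ler_norm.
Qed.

Lemma weak_solution_unique W c d nu a S T : W != 0 -> 0 < c ->
  measurable_fun setT nu -> measurable_fun setT a ->
  (forall x, c <= a x * nu x <= d) ->
  [/\ weak_solution nu a W S, S 0 = 0 & at_most_linear S] ->
  [/\ weak_solution nu a W T, T 0 = 0 & at_most_linear T] -> S = T.
Proof.
move=> W0 c0 mnu ma pcd [[cS [gS wS eS]] S0 [CS lS]] [[cT [gT wT eT]] T0 [CT lT]].
pose p x := a x * nu x; pose D := S \- T; pose g := gS \- gT.
have p0 x : 0 < p x by apply: lt_le_trans c0 _; case/andP: (pcd x).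
have mp : measurable_fun setT p by exact: measurable_funM.
have cD : continuous D by move=> x; apply: cvgB; [exact: cS|exact: cT].
have wD : weak_derivative D g by exact: weak_derivativeB.
have [lD lg wg] := wD.
have lp h : locally_integrable setT h ->
    locally_integrable setT (fun x => p x * h x).
  move=> lh; apply: locally_integrableM => // K _.
  by apply: (@boundedP _ _ (`|c| + `|d|)) => x; exact/norm_between/pcd.
have lW k h : locally_integrable setT h ->
    locally_integrable setT (fun x => k * h x).
  move=> lh; apply: (locally_integrableM (h := cst k)) => // K _.
  exact: (@boundedP _ _ `|k|).
pose f x := p x * g x - W * D x.
have lf : locally_integrable setT f.
  by apply: locally_integrableB; [exact: lp|exact: lW].
have [_ lgS _] := wS; have [_ lgT _] := wT.
(* Subtracting the two equations leaves [p * g * phi' + W * g * phi] with integral zero; as [g] is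
   the weak derivative of [D], the second term may be replaced by [- W * D * phi']. *)
have f0 phi : test_function phi -> \int[leb]_x (f x * derive1 phi x) = 0.
  move=> tp; have := eS _ tp; rewrite -(eT _ tp).
  have iS1 := integrable_derive_test (lp _ lgS) tp.
  have iT1 := integrable_derive_test (lp _ lgT) tp.
  have iS2 := integrable_test (lW W _ lgS) tp.
  have iT2 := integrable_test (lW W _ lgT) tp.
  rewrite !RintegralD// => E.
  have ipg := integrable_derive_test (lp _ lg) tp.
  have iD := integrable_derive_test lD tp.
  have ig := integrable_test lg tp.
  rewrite (@eq_Rintegral _ _ _ leb setT
    (fun x => p x * g x * derive1 phi x - W * (D x * derive1 phi x))); last first.
    by move=> x _; rewrite /f; ring.
  rewrite RintegralB//; last exact: integrable_scale.
  rewrite RintegralZl// wg// mulrN opprK -RintegralZl//.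
  rewrite (@eq_Rintegral _ _ _ leb setT
    (fun x => p x * gS x * derive1 phi x - p x * gT x * derive1 phi x)); last first.
    by move=> x _; rewrite /g /=; ring.
  rewrite [X in _ + X](@eq_Rintegral _ _ _ leb setT
    (fun x => W * gS x * phi x - W * gT x * phi x)); last first.
    by move=> x _; rewrite /g /=; ring.
  by rewrite !RintegralB//; lra.
have [k fk] := weakly_constant lf f0.
(* Almost everywhere [p * g = W * D + k = u], so [u' = W * g = beta * u]. *)
pose u x := W * D x + k; pose beta x := W * (p x)^-1.
have mbeta : measurable_fun setT beta.
  apply: measurable_funM => //; apply: (measurable_inv c0) => // x.
  by case/andP: (pcd x).
have cu : continuous u.
  by move=> x; apply: cvgD; [apply: cvgM; [exact: cvg_cst|exact: cD]|exact: cvg_cst].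
have PD := weak_derivative_primitive_of cD wD.
have Pu : primitive_of u (fun x => beta x * u x).
  move=> x y xy; rewrite /u.
  have -> : W * D y + k - (W * D x + k) = W * (D y - D x) by ring.
  rewrite PD// -RintegralZl//; last exact: locally_integrable_segment.
  congr fine; apply: ae_eq_integral => //.
  - apply/measurable_EFinP; apply: measurable_funTS.
    by case: (lW W _ lg).
  - apply/measurable_EFinP; apply: measurable_funTS.
    by apply: measurable_funM => //; exact: continuous_measurable_fun.
  - apply: filterS fk => [|t]; first exact: (ae_filter_ringOfSetsType leb).
    rewrite /f => ft _; congr EFin; rewrite /beta -ft; field.
    by rewrite gt_eqF.
have uC x : `|u x| <= (`|W| * (`|CS| + `|CT|) + `|k|) * (1 + `|x|).
  have hS := at_most_linear_norm S0 lS x; have hT := at_most_linear_norm T0 lT x.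
  have hD : `|D x| <= (`|CS| + `|CT|) * `|x|.
    by rewrite /D /= (le_trans (ler_normB _ _))// mulrDl lerD.
  have hu : `|u x| <= `|W| * `|D x| + `|k| by rewrite -normrM ler_normD.
  have hW : `|W| * `|D x| <= `|W| * ((`|CS| + `|CT|) * `|x|) by rewrite ler_wpM2l.
  have n1 : 0 <= `|W| * (`|CS| + `|CT|) by rewrite mulr_ge0// addr_ge0.
  have n2 : 0 <= `|k| * `|x| by rewrite mulr_ge0.
  rewrite mulrA in hW; rewrite mulrDr mulr1 mulrDl; lra.
have d0 : 0 < d by apply: lt_le_trans (p0 0) _; case/andP: (pcd 0).
have pV x : d^-1 <= (p x)^-1 <= c^-1.
  by rewrite !lef_pV2 ?posrE// andbC; exact: pcd.
have u0 : forall x, u x = 0.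
  have [Wn|Wp|/eqP] := ltgtP W 0; last by rewrite (negbTE W0).
    have Wn' : 0 < - W by rewrite oppr_gt0.
    apply: (linear_ode_eq0N (c := - W / d) (d := - W / c) cu mbeta _ _ Pu uC).
      exact: divr_gt0.
    by move=> x; rewrite /beta -mulNr !ler_pM2l.
  apply: (linear_ode_eq0 (c := W / d) (d := W / c) cu mbeta _ _ Pu uC).
    exact: divr_gt0.
  by move=> x; rewrite /beta !ler_pM2l.
(* From [u x = u 0] the unknown [k] cancels, and [W != 0] leaves [D x = D 0 = 0]. *)
apply/funext => x; have := u0 x; rewrite -(u0 0) /u => /addIr /(mulfI W0).
by rewrite /D /= S0 T0; lra.
Qed.

End final.

Theorem proposition1p2 (R : realType) (mu : R) (nu a : R -> R) (W : R) :
  0 < mu ->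
  measurable_fun setT nu ->
  measurable_fun setT a ->
  {ae lebesgue_measure, forall x, 1 / mu <= nu x <= mu} ->
  {ae lebesgue_measure, forall x, 1 / mu <= a x <= mu} ->
  exists T : R -> R,
    [/\ weak_solution nu a W T, T 0 = 0 & at_most_linear T] /\
    (W != 0 -> forall S : R -> R,
       [/\ weak_solution nu a W S, S 0 = 0 & at_most_linear S] -> S = T) /\
    derivative_between (1 / mu ^+ 5) (mu ^+ 5) T.
Proof.
move=> mu0 mnu ma nub ab.
(* The line has positive measure, so the almost-everywhere bound on [nu] holds at some point at
   least; together with [0 < mu] this later gives [1 <= mu]. *)
have mu1 : 1 / mu <= mu.
  have pf : ProperFilter (almost_everywhere (@lebesgue_measure R)).
    apply: ae_properfilter_algebraOfSetsType.
    have : (0 < lebesgue_measure [set: R])%E.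
      by rewrite -set_itvNyy lebesgue_measure_itv/= addye ?ltry.
    exact.
  have [x /andP[]] := filter_ex nub; exact: le_trans.
(* Truncation changes the coefficients on a null set only and makes the bounds hold at every point,
   as the fixed-point and growth arguments require. *)
pose clamp (f : R -> R) x := Num.max (1 / mu) (Num.min mu (f x)).
have clampb f x : 1 / mu <= clamp f x <= mu.
  by rewrite /clamp le_max lexx/= ge_max mu1 ge_min lexx.
have mclamp f : measurable_fun setT f -> measurable_fun setT (clamp f).
  move=> mf; apply: measurable_maxr => //; exact: measurable_minr.
have clampE (f : R -> R) : {ae lebesgue_measure, forall x, 1 / mu <= f x <= mu} ->
    {ae lebesgue_measure, forall x, f x = clamp f x}.
  apply: filterS; first exact: (ae_filter_ringOfSetsType (@lebesgue_measure R)).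
  by move=> x /andP[h1 h2]; rewrite /clamp min_r// max_r.
have mulem : 1 <= mu.
  by move: mu1; rewrite ler_pdivrMr//; nra.
pose n' := clamp nu; pose a' := clamp a.
have [mn' ma'] := (mclamp _ mnu, mclamp _ ma).
have eqn' := clampE _ nub; have eqa' := clampE _ ab.
have eqn'' : {ae lebesgue_measure, forall x, n' x = nu x}.
  apply: filterS eqn' => [|x -> //]; exact: (ae_filter_ringOfSetsType (@lebesgue_measure R)).
have eqa'' : {ae lebesgue_measure, forall x, a' x = a x}.
  apply: filterS eqa' => [|x -> //]; exact: (ae_filter_ringOfSetsType (@lebesgue_measure R)).
have to' S : weak_solution nu a W S -> weak_solution n' a' W S.
  exact: weak_solution_ae.
have [T [wT T0 lT dT]] := exists_weak_solution W mu0 mulem mn' ma'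
  (clampb nu) (clampb a).
exists T; split.
  by split => //; apply: weak_solution_ae wT.
split=> // W0 S [wS S0 lS].
apply: (@weak_solution_unique _ W (1 / mu * (1 / mu)) (mu * mu) n' a') => //.
- by rewrite mulr_gt0// divr_gt0.
- move=> x; have /andP[n1 n2] := clampb nu x; have /andP[a1 a2] := clampb a x.
  have k0 : 0 <= 1 / mu by rewrite divr_ge0// ltW.
  by rewrite !ler_pM// ?(le_trans k0 n1)// (le_trans k0 a1).
- by split=> //; exact: to'.
Qed.
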